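(* Let $A$ be a Banach lattice algebra with identity $e$, let $A_\mathbb C$ be its complexification and let $(A_\mathbb C)_e=\{w\in A_\mathbb C: |w|\le\lambda e\text{ for some }\lambda\ge0\}$. Then $(A_\mathbb C)_e=(A_e)_\mathbb C=A_e+iA_e$, and: (i) for every $z\in(A_\mathbb C)_e$ one has $\|z\|_\mathbb C=\|z\|_e=r(z)$, where $\|z\|_e=\inf\{\lambda>0:|z|\le\lambda e\}$ and $r(z)$ is the spectral radius of $z$ in $A_\mathbb C$; and $((A_\mathbb C)_e,\|\cdot\|_\mathbb C)$ is isometrically lattice and algebra isomorphic to $C(K,\mathbb C)$ for some compact Hausdorff $K$; in particular, on $A_e$ the norms $\|\cdot\|$ and $\|\cdot\|_e$ coincide; (ii) $(A_\mathbb C)_e$ is a projection band in $A_\mathbb C$, i.e. $A_\mathbb C=(A_\mathbb C)_e\oplus (A_\mathbb C)_e^{d}$ where $(A_\mathbb C)_e^d=\{z: |w|\wedge|z|=0\ \forall w\in(A_\mathbb C)_e\}$; (iii) $(A_\mathbb C)_e$ is an inverse closed subalgebra of $A_\mathbb C$.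
   Context: A Banach lattice algebra is a real Banach lattice $A$ with an associative bilinear product making it a Banach algebra such that $xy\ge0$ whenever $x,y\ge0$; identity $e$ means a multiplicative identity with $\|e\|=1$. $A_e=\{x\in A:|x|\le\lambda e \text{ for some }\lambda\ge0\}$. The complexification $A_\mathbb C=\{x+iy: x,y\in A\}$ has modulus $|x+iy|=\sup_{0\le\theta\le2\pi}(x\cos\theta+y\sin\theta)$ (supremum in $A$), norm $\|z\|_\mathbb C=\||z|\|$, and product $(x_1+ix_2)(y_1+iy_2)=(x_1y_1-x_2y_2)+i(x_1y_2+x_2y_1)$; it is a complex Banach algebra with identity $e$. $C(K,\mathbb C)$ carries pointwise operations, pointwise modulus and sup norm. Inverse closed means: if $b$ in the subalgebra is invertible in $A_\mathbb C$ then $b^{-1}$ lies in the subalgebra. *)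

(* Defs.v *)
From HB Require Import structures.
From mathcomp Require Import all_boot all_order all_algebra.
From mathcomp Require Import all_classical all_reals all_analysis.
From mathcomp Require Import complex.
Set Implicit Arguments. Unset Strict Implicit. Unset Printing Implicit Defensive.
Import Order.TTheory GRing.Theory Num.Theory.
Import numFieldNormedType.Exports.
Local Open Scope classical_set_scope.
Local Open Scope ring_scope.

Section BLA.
Variables (R : realType) (A : completeNormedModType R).
Variables (le : A -> A -> Prop) (join : A -> A -> A)
          (mul : A -> A -> A) (e : A).

Definition lmeet (x y : A) : A := - join (- x) (- y).
Definition labs (x : A) : A := join x (- x).

Record BanachLatticeAlgebra : Prop := {
  le_refl' : forall x, le x x;
  le_anti' : forall x y, le x y -> le y x -> x = y;
  le_trans' : forall x y z, le x y -> le y z -> le x z;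
  le_add' : forall x y z, le x y -> le (x + z) (y + z);
  le_scale' : forall (a : R) x y, 0 <= a -> le x y -> le (a *: x) (a *: y);
  join_ubl : forall x y, le x (join x y);
  join_ubr : forall x y, le y (join x y);
  join_lub : forall x y z, le x z -> le y z -> le (join x y) z;
  (* lattice norm (Banach lattice; completeness comes from A) *)
  lattice_norm : forall x y, le (labs x) (labs y) -> `|x| <= `|y|;
  mulDl : forall x y z, mul (x + y) z = mul x z + mul y z;
  mulDr : forall x y z, mul x (y + z) = mul x y + mul x z;
  mulZl : forall (a : R) x y, mul (a *: x) y = a *: mul x y;
  mulZr : forall (a : R) x y, mul x (a *: y) = a *: mul x y;
  mulA' : forall x y z, mul x (mul y z) = mul (mul x y) z;
  mul_norm : forall x y, `|mul x y| <= `|x| * `|y|;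
  mul_ge0 : forall x y, le 0 x -> le 0 y -> le 0 (mul x y);
  mul1x : forall x, mul e x = x;
  mulx1 : forall x, mul x e = x;
  norm_e1 : `|e| = 1
}.

Definition Ae : set A := [set x | exists l : R, 0 <= l /\ le (labs x) (l *: e)].

Definition is_lub (S : set A) (m : A) : Prop :=
  (forall s, S s -> le s m) /\ (forall u, (forall s, S s -> le s u) -> le m u).

(* The complexification A_C = A x A  (z = (x, y) stands for x + i y).   *)
Definition cplx := (A * A)%type.

Definition cxadd (z w : cplx) : cplx := (z.1 + w.1, z.2 + w.2).
Definition cxopp (z : cplx) : cplx := (- z.1, - z.2).
Definition cxscale (c : R[i]) (z : cplx) : cplx :=
  ((complex.Re c : R) *: z.1 - (complex.Im c : R) *: z.2, (complex.Re c : R) *: z.2 + (complex.Im c : R) *: z.1).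
Definition cxmul (z w : cplx) : cplx :=
  (mul z.1 w.1 - mul z.2 w.2, mul z.1 w.2 + mul z.2 w.1).
Definition cxone : cplx := (e, 0).

Definition cxmod (z : cplx) : A :=
  xget 0 [set m | is_lub [set cos t *: z.1 + sin t *: z.2
                         | t in [set t : R | 0 <= t <= 2 * pi]] m].

Definition cxnorm (z : cplx) : R := `|cxmod z|.

Definition ACe : set cplx := [set z | exists l : R, 0 <= l /\ le (cxmod z) (l *: e)].

Definition norm_e (z : cplx) : R := inf [set l : R | 0 < l /\ le (cxmod z) (l *: e)].

Definition cinvertible (z : cplx) : Prop :=
  exists w, cxmul z w = cxone /\ cxmul w z = cxone.

Definition cxabs (c : R[i]) : R := Num.sqrt (complex.Re c ^+ 2 + complex.Im c ^+ 2).

Definition spectrum (z : cplx) : set R[i] :=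
  [set c | ~ cinvertible (cxadd z (cxopp (cxscale c cxone)))].

Definition spectral_radius (z : cplx) : R := sup [set cxabs c | c in spectrum z].

Definition disjoint_compl (E : set cplx) : set cplx :=
  [set z | forall w, E w -> lmeet (cxmod w) (cxmod z) = 0].

End BLA.

Definition continuousC (R : realType) (K : topologicalType) (f : K -> R[i]) : Prop :=
  continuous (fun k => complex.Re (f k) : R) /\ continuous (fun k => complex.Im (f k) : R).

Definition supnormC (R : realType) (K : topologicalType) (f : K -> R[i]) : R :=
  sup [set cxabs (f k) | k in [set: K]].

Definition iso_CK (R : realType) (A : completeNormedModType R)
  (le : A -> A -> Prop) (mul : A -> A -> A) (K : topologicalType)
  (E : set (cplx A)) (Phi : cplx A -> K -> R[i]) : Prop :=
  (forall z, E z -> continuousC (Phi z)) /\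
  (forall f : K -> R[i], continuousC f -> exists2 z, E z & Phi z = f) /\
  (forall z w, E z -> E w -> Phi z = Phi w -> z = w) /\
  (forall z w, E z -> E w -> Phi (cxadd z w) = (fun k => Phi z k + Phi w k)) /\
  (forall c z, E z -> Phi (cxscale c z) = (fun k => c * Phi z k)) /\
  (forall z w, E z -> E w -> Phi (cxmul mul z w) = (fun k => Phi z k * Phi w k)) /\
  (forall z, E z -> Phi (cxmod le z, 0) = (fun k => Complex (cxabs (Phi z k)) 0)) /\
  (forall z, E z -> cxnorm le z = supnormC (Phi z)).

(* Main.v *)
Require Import Defs.
From HB Require Import structures.
From mathcomp Require Import all_boot all_order all_algebra.
From mathcomp Require Import all_classical all_reals all_analysis.
From mathcomp Require Import complex ring lra.
Import Order.TTheory GRing.Theory Num.Theory.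
Import numFieldNormedType.Exports.
Local Open Scope classical_set_scope.
Local Open Scope ring_scope.

(** The powers of e^+ = e + e^- have norm at most 1 and dominate e + k e^-, which
    forces e >= 0.  The key estimate is x <= |x| e for 0 <= x in A_e: with
    g = (x - m e)^+ one has x g >= m g, hence m |g| <= |x| |g| and g = 0 as soon
    as m > |x|.  So the norm is the order unit norm on A_e, and a /\ n e stops
    growing at n = |a|, which makes A_e a projection band.  Multiplication by an
    element of A_e preserves the band decomposition, whence inverse closedness.

    The residue fields of the maximal order ideals avoiding e are R; they give
    the characters of A_e (real algebra and lattice homomorphisms), which form a
    compact set K for pointwise convergence and recover the norm.  The lattice
    form of the Stone-Weierstrass theorem and the completeness of A make
    A_e -> C(K) onto.  By inverse closedness the spectrum of z is the range of
    its transform. *)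

Set Implicit Arguments.
Unset Strict Implicit.
Unset Printing Implicit Defensive.

(** The axioms give positivity of products of positive elements, but not that multiplication
    respects disjointness. What rescues A_e is domination: if |b| <= l e then |b x| <= l |x|, so
    multiplying by b never leaves the band of x, and disjoint positive elements of A_e have product
    0. This is the function-algebra behaviour from which the norm estimate, the multiplicativity of
    the residues and inverse closedness are drawn. Two facts often taken for granted need proofs.
    The Archimedean property comes from the lattice norm. The supremum defining the modulus exists
    because [A] is complete and finitely many angles approximate the circle; without this, [cxmod]
    could be its default value 0. Characters preserve finite suprema only, while the modulus is a
    supremum over a continuum; this is why its transform is computed only after surjectivity is
    known. The spectrum is taken in A_C, where characters carry no information outside A_e, so
    inverse closedness has to be proved independently of them. *)

Section LinearReflection.
Variables (R : realType) (V : lmodType R).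

(** * Reflection for linear identities between vectors *)

Inductive lexp := LVar of nat | LZero | LAdd of lexp & lexp | LOpp of lexp
  | LScale of R & lexp.

Fixpoint leval (s : seq V) (t : lexp) : V :=
  match t with
  | LVar n => nth 0 s n
  | LZero => 0
  | LAdd a b => leval s a + leval s b
  | LOpp a => - leval s a
  | LScale c a => c *: leval s a
  end.

Fixpoint lcoef (n : nat) (t : lexp) : R :=
  match t with
  | LVar m => if eqn n m then 1 else 0
  | LZero => 0
  | LAdd a b => lcoef n a + lcoef n b
  | LOpp a => - lcoef n a
  | LScale c a => c * lcoef n a
  end.

(** A recursive conjunction rather than a quantifier over indices, so that [cbn] and [split] leave
    one scalar equation per atom. *)
Fixpoint lcoef_eq (n : nat) (t u : lexp) : Prop :=
  match n with
  | O => True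
  | S m => lcoef m t = lcoef m u /\ lcoef_eq m t u
  end.

Lemma leval_sum s t : leval s t = \sum_(i < size s) lcoef i t *: nth 0 s i.
Proof.
elim: t => [n||a iha b ihb|a iha|c a iha] /=; rewrite ?iha ?ihb.
(* An index past the end of the list reads the default 0 and meets no term of the sum. *)
- have [ns|sn] := ltnP n (size s); last first.
    rewrite nth_default// big1// => i _.
    rewrite eqnE ltn_eqF ?scale0r//; exact: leq_trans sn.
  rewrite (bigD1 (Ordinal ns)) //= eqnE eqxx scale1r big1 ?addr0// => i.
  by rewrite -val_eqE /= => /negbTE ->; rewrite scale0r.
- by rewrite big1// => i _; rewrite scale0r.
- by rewrite -big_split; apply: eq_bigr => i _; rewrite scalerDl.
- by rewrite -sumrN; apply: eq_bigr => i _; rewrite scaleNr.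
- by rewrite scaler_sumr; apply: eq_bigr => i _; rewrite scalerA.
Qed.

Lemma lcoef_eqP s t u : lcoef_eq (size s) t u -> leval s t = leval s u.
Proof.
rewrite !leval_sum; elim: (size s) => [|n IH] /=; first by rewrite !big_ord0.
by case=> e1 /IH e2; rewrite !big_ord_recr /= e1 e2.
Qed.

End LinearReflection.

Ltac lin_index x s :=
  match s with
  | x :: _ => constr:(O)
  | _ :: ?s' => let n := lin_index x s' in constr:(S n)
  end.

Ltac lin_atom x s :=
  match s with
  | context [x :: _] => s
  | _ => constr:(x :: s)
  end.

Ltac lin_atoms t s :=
  match t with
  | (?a + ?b)%R => let s1 := lin_atoms a s in lin_atoms b s1
  | (- ?a)%R => lin_atoms a s
  | (_ *: ?a)%R => lin_atoms a s
  | (0)%R => s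
  | _ => lin_atom t s
  end.

Ltac lin_reify R t s :=
  match t with
  | (?a + ?b)%R => let u := lin_reify R a s in let v := lin_reify R b s in
                   constr:(@LAdd R u v)
  | (- ?a)%R => let u := lin_reify R a s in constr:(@LOpp R u)
  | (?c *: ?a)%R => let u := lin_reify R a s in constr:(@LScale R c u)
  | (0)%R => constr:(@LZero R)
  | _ => let n := lin_index t s in constr:(@LVar R n)
  end.

(* Proves an identity between linear combinations of vectors by comparing the
   coefficients of each atom in R. *)
Ltac lin_eq R V :=
  match goal with
  | |- ?t = ?u =>
    let s0 := constr:(@nil V) in
    let s1 := lin_atoms t s0 in
    let s := lin_atoms u s1 in
    let t' := lin_reify R t s in
    let u' := lin_reify R u s in
    refine (@lcoef_eqP R V s t' u' _);
    cbn [lcoef_eq lcoef eqn size];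
    repeat split; try by [|ring|lra|field]
  end.

(** * Order, lattice and norm calculus *)

Section BanachLatticeAlgebra_unit.
Variables (R : realType) (A : completeNormedModType R).
Variables (le : A -> A -> Prop) (join mul : A -> A -> A) (e : A).
Hypothesis bla : BanachLatticeAlgebra le join mul e.

Local Notation labs := (labs join).
Local Notation lmeet := (lmeet join).
Ltac lin := lin_eq R A.

Definition pos_part (x : A) : A := join x 0.

(* For a, b >= 0 this says that the meet of a and b is 0. *)
Definition disjoint_elt (a b : A) : Prop :=
  forall z, le z a -> le z b -> le z 0.

Lemma vle_refl x : le x x. Proof. exact: (le_refl' bla). Qed.

Lemma vle_anti x y : le x y -> le y x -> x = y.
Proof. exact: (le_anti' bla). Qed.

Lemma vle_trans y x z : le x y -> le y z -> le x z.
Proof. exact: (le_trans' bla). Qed.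

Lemma leD x y z t : le x y -> le z t -> le (x + z) (y + t).
Proof.
move=> xy zt; apply: (@vle_trans (y + z)); first exact: (le_add' bla).
by rewrite ![y + _]addrC; apply: (le_add' bla).
Qed.

Lemma leZ (a : R) x y : 0 <= a -> le x y -> le (a *: x) (a *: y).
Proof. exact: (le_scale' bla). Qed.

(** An inequality depends only on the difference of its sides. Most order arguments below therefore
    combine known inequalities and leave a linear identity to [lin]. *)
Lemma le_shift x y x' y' : le x y -> y - x = y' - x' -> le x' y'.
Proof.
move=> xy d; have := le_add' bla (x' - x) xy.
have -> : x + (x' - x) = x' by lin.
suff -> : y + (x' - x) = y' by [].
have -> : y + (x' - x) = (y - x) + x' by lin.
by rewrite d; lin.
Qed.

Lemma leN x y : le x y -> le (- y) (- x).
Proof. by move=> xy; apply: (le_shift xy); lin. Qed.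

Lemma leZI (a : R) x y : 0 < a -> le (a *: x) (a *: y) -> le x y.
Proof.
move=> a0 /(leZ (ltW (_ : 0 < a^-1))); rewrite invr_gt0 => /(_ a0).
by rewrite !scalerA mulVf ?gt_eqF// !scale1r.
Qed.

Lemma leZl (a b : R) x : le 0 x -> a <= b -> le (a *: x) (b *: x).
Proof.
move=> x0 ab; have ba : 0 <= b - a by lra.
by apply: (le_shift (leZ ba x0)); lin.
Qed.

Lemma scale_ge0 (a : R) x : 0 <= a -> le 0 x -> le 0 (a *: x).
Proof. by move=> a0 x0; rewrite -(scaler0 A a); apply: leZ. Qed.

Lemma add_ge0 x y : le 0 x -> le 0 y -> le 0 (x + y).
Proof. by move=> x0 y0; rewrite -[0]addr0; apply: leD. Qed.

Lemma le_joinl x y : le x (join x y). Proof. exact: (join_ubl bla). Qed.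
Lemma le_joinr x y : le y (join x y). Proof. exact: (join_ubr bla). Qed.

Lemma join_le x y z : le x z -> le y z -> le (join x y) z.
Proof. exact: (join_lub bla). Qed.

Lemma joinC x y : join x y = join y x.
Proof.
by apply: vle_anti; apply: join_le; rewrite ?le_joinl ?le_joinr //;
  [exact: le_joinr|exact: le_joinl|exact: le_joinr|exact: le_joinl].
Qed.

Lemma join_eql x y : le y x -> join x y = x.
Proof.
move=> yx; apply: vle_anti; last exact: le_joinl.
by apply: join_le => //; exact: vle_refl.
Qed.

Lemma joinDr x y z : join (x + z) (y + z) = join x y + z.
Proof.
apply: vle_anti.
  by apply: join_le; apply: leD;
    [exact: le_joinl|exact: vle_refl|exact: le_joinr|exact: vle_refl].
have h : le (join x y) (join (x + z) (y + z) - z).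
  apply: join_le.
    by apply: (le_shift (le_joinl (x + z) (y + z))); lin.
  by apply: (le_shift (le_joinr (x + z) (y + z))); lin.
by apply: (le_shift h); lin.
Qed.

Lemma meet_lel x y : le (lmeet x y) x.
Proof. by apply: (le_shift (le_joinl (- x) (- y))); rewrite /lmeet; lin. Qed.

Lemma meet_ler x y : le (lmeet x y) y.
Proof. by apply: (le_shift (le_joinr (- x) (- y))); rewrite /lmeet; lin. Qed.

Lemma le_meet x y z : le z x -> le z y -> le z (lmeet x y).
Proof.
move=> /leN zx /leN zy; apply: (le_shift (join_le zx zy)).
by rewrite /lmeet; lin.
Qed.

Lemma le_abs x : le x (labs x). Proof. exact: le_joinl. Qed.
Lemma leN_abs x : le (- x) (labs x). Proof. exact: le_joinr. Qed.

Lemma abs_le x y : le x y -> le (- x) y -> le (labs x) y.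
Proof. exact: join_le. Qed.

Lemma abs_ge0 x : le 0 (labs x).
Proof.
apply: (@leZI 2) => //; apply: (le_shift (leD (le_abs x) (leN_abs x))).
by lin.
Qed.

Lemma ge0_abs x : le 0 x -> labs x = x.
Proof.
move=> x0; apply: join_eql; apply: (@vle_trans 0) => //.
by apply: (le_shift x0); lin.
Qed.

Lemma absN x : labs (- x) = labs x.
Proof. by rewrite /Defs.labs opprK joinC. Qed.

Lemma absD x y : le (labs (x + y)) (labs x + labs y).
Proof.
apply: abs_le; first by apply: leD; apply: le_abs.
by rewrite opprD; apply: leD; apply: leN_abs.
Qed.

(** [a *: x] is the combination of x and -x with coefficients (b + a)/2 and (b - a)/2, which are
    nonnegative and add up to b. *)
Lemma absZ_le (a b : R) x : `|a| <= b -> le (labs (a *: x)) (b *: labs x).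
Proof.
move=> ab; apply: abs_le.
  have h1 : 0 <= (b + a) / 2 by move: (ler_norm (- a)); rewrite normrN; lra.
  have h2 : 0 <= (b - a) / 2 by move: (ler_norm a); lra.
  by apply: (le_shift (leD (leZ h1 (le_abs x)) (leZ h2 (leN_abs x)))); lin.
have h1 : 0 <= (b - a) / 2 by move: (ler_norm a); lra.
have h2 : 0 <= (b + a) / 2 by move: (ler_norm (- a)); rewrite normrN; lra.
by apply: (le_shift (leD (leZ h1 (le_abs x)) (leZ h2 (leN_abs x)))); lin.
Qed.

Lemma absZ (a : R) x : labs (a *: x) = `|a| *: labs x.
Proof.
apply: vle_anti; first exact: absZ_le.
have [->|a0] := eqVneq a 0; first by rewrite normr0 !scale0r; exact: abs_ge0.
have a0' : 0 < `|a| by rewrite normr_gt0.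
have ai : 0 <= `|a| by [].
have := leZ ai (@absZ_le (a^-1) (`|a|^-1) (a *: x) _).
by rewrite normfV lexx => /(_ isT); rewrite !scalerA mulVf// mulfV ?gt_eqF// !scale1r.
Qed.

Lemma norm_abs x : `|labs x| = `|x|.
Proof.
have h : labs (labs x) = labs x by apply: ge0_abs; exact: abs_ge0.
by apply/eqP; rewrite eq_le; apply/andP; split; apply: (lattice_norm bla);
  rewrite h; exact: vle_refl.
Qed.

Lemma le_norm x y : le (labs x) y -> `|x| <= `|y|.
Proof.
move=> xy; apply: (lattice_norm bla); rewrite (@ge0_abs y) //.
exact: vle_trans (abs_ge0 x) xy.
Qed.

Lemma ge0_le_norm x y : le 0 x -> le x y -> `|x| <= `|y|.
Proof. by move=> x0 xy; apply: le_norm; rewrite ge0_abs. Qed.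

Lemma pos_ge0 x : le 0 (pos_part x). Proof. exact: le_joinr. Qed.
Lemma le_pos x : le x (pos_part x). Proof. exact: le_joinl. Qed.

Lemma pos_le x y : le x y -> le 0 y -> le (pos_part x) y.
Proof. exact: join_le. Qed.

Lemma pos_partE x : x = pos_part x - pos_part (- x).
Proof.
rewrite /pos_part; have -> : join x 0 = join (- x) 0 + x; last by lin.
by rewrite -joinDr addNr add0r joinC.
Qed.

Lemma pos_le_abs x : le (pos_part x) (labs x).
Proof. by apply: pos_le; [exact: le_abs|exact: abs_ge0]. Qed.

(** If z lies below both parts, then x^+ - z = x + (x^- - z) still dominates x and 0, so minimality
    of x^+ gives x^+ <= x^+ - z. *)
Lemma disjoint_pos x : disjoint_elt (pos_part x) (pos_part (- x)).
Proof.
move=> z zp zn; have h : le (pos_part x) (pos_part x - z).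
  apply: pos_le; last by apply: (le_shift zp); lin.
  have -> : pos_part x - z = x + (pos_part (- x) - z).
    by rewrite {2}(pos_partE x); lin.
  by apply: (le_shift zn); lin.
by apply: (le_shift h); lin.
Qed.

(* Covers both the Archimedean property and the closedness of the cone. *)
Lemma le0_approx x :
  (forall eps : R, 0 < eps -> exists2 y, le x y & `|y| <= eps) -> le x 0.
Proof.
move=> h; suff : pos_part x = 0 by move=> <-; exact: le_pos.
apply/normr0_eq0/eqP; rewrite eq_le normr_ge0 andbT.
apply/ler_addgt0Pl => eps /h [y xy ye]; rewrite addr0.
apply: le_trans ye; rewrite -(norm_abs y); apply: ge0_le_norm.
  exact: pos_ge0.
apply: pos_le; last exact: abs_ge0.
exact: vle_trans xy (le_abs y).
Qed.

Lemma le_archimedean x y u :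
  (forall eps : R, 0 < eps -> le x (y + eps *: u)) -> le x y.
Proof.
move=> h; suff k : le (x - y) 0 by apply: (le_shift k); lin.
apply: le0_approx => eps eps0; have u1 : 0 < `|u| + 1 by apply: ltr_wpDl.
(* Dividing by |u| + 1 instead of |u| covers u = 0. *)
exists ((eps / (`|u| + 1)) *: u).
  by apply: (le_shift (h (eps / (`|u| + 1)) _)); [apply: divr_gt0|lin].
have k : (`|u| + 1)^-1 * `|u| <= 1 by rewrite mulrC ler_pdivrMr// mul1r; lra.
by rewrite normrZ gtr0_norm ?divr_gt0// -mulrA ler_piMr// ltW.
Qed.

Lemma disjointC a b : disjoint_elt a b -> disjoint_elt b a.
Proof. by move=> h z zb za; apply: h. Qed.

Lemma disjoint_le a b a' b' : le a' a -> le b' b ->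
  disjoint_elt a b -> disjoint_elt a' b'.
Proof.
by move=> aa bb h z za zb; apply: h; [apply: vle_trans aa|apply: vle_trans bb].
Qed.

(** One positive [M] above both l and m suffices: z / M then lies below a and b. The scalars may
    have any sign. *)
Lemma disjoint_scale a b (l m : R) : le 0 a -> le 0 b ->
  disjoint_elt a b -> disjoint_elt (l *: a) (m *: b).
Proof.
move=> a0 b0 h z zl zm; pose M := `|l| + `|m| + 1.
have M0 : 0 < M by rewrite /M ltr_wpDl ?addr_ge0.
have lM : l <= M by rewrite /M; move: (ler_norm l) (normr_ge0 m); lra.
have mM : m <= M by rewrite /M; move: (ler_norm m) (normr_ge0 l); lra.
apply: (@leZI M^-1); first by rewrite invr_gt0.
rewrite scaler0; apply: h; apply: (@leZI M) => //;
  rewrite scalerA mulfV ?gt_eqF// scale1r.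
  by apply: vle_trans zl _; exact: leZl.
by apply: vle_trans zm _; exact: leZl.
Qed.

(** If z <= u and z <= a + b, then z - b lies below u and a, so z <= b; now z lies below u and b. *)
Lemma disjointD u a b : le 0 u -> le 0 a -> le 0 b ->
  disjoint_elt u a -> disjoint_elt u b -> disjoint_elt u (a + b).
Proof.
move=> u0 a0 b0 ua ub z zu zab; apply: ub => //.
have : le (z - b) 0.
  apply: ua; last by apply: (le_shift zab); lin.
  by apply: (le_shift (leD zu b0)); lin.
by move=> k; apply: (le_shift k); lin.
Qed.

Lemma disjoint_meet a b : le 0 a -> le 0 b ->
  disjoint_elt a b <-> lmeet a b = 0.
Proof.
move=> a0 b0; split=> [h|h z za zb]; last by rewrite -h; exact: le_meet.
apply: vle_anti; last exact: le_meet.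
by apply: h; [exact: meet_lel|exact: meet_ler].
Qed.

(** * The product, and its interplay with the order *)

Lemma mulDlA x y z : mul (x + y) z = mul x z + mul y z.
Proof. exact: (mulDl bla). Qed.
Lemma mulDrA x y z : mul x (y + z) = mul x y + mul x z.
Proof. exact: (mulDr bla). Qed.
Lemma mulZlA (a : R) x y : mul (a *: x) y = a *: mul x y.
Proof. exact: (mulZl bla). Qed.
Lemma mulZrA (a : R) x y : mul x (a *: y) = a *: mul x y.
Proof. exact: (mulZr bla). Qed.
Lemma mulNlA x y : mul (- x) y = - mul x y.
Proof. by rewrite -scaleN1r mulZlA scaleN1r. Qed.
Lemma mulNrA x y : mul x (- y) = - mul x y.
Proof. by rewrite -scaleN1r mulZrA scaleN1r. Qed.
Lemma mul0A x : mul 0 x = 0.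
Proof. by have := mulZlA 0 x x; rewrite !scale0r. Qed.
Lemma mulA0 x : mul x 0 = 0.
Proof. by have := mulZrA 0 x x; rewrite !scale0r. Qed.

Definition mulE := (mulDlA, mulDrA, mulZlA, mulZrA, mulNlA, mulNrA, mul0A, mulA0,
  mul1x bla, mulx1 bla).

Lemma le_mul2l a x y : le 0 a -> le x y -> le (mul a x) (mul a y).
Proof.
move=> a0 xy; have yx : le 0 (y - x) by apply: (le_shift xy); lin.
by apply: (le_shift (mul_ge0 bla a0 yx)); rewrite !mulE; lin.
Qed.

Lemma le_mul2r a x y : le 0 a -> le x y -> le (mul x a) (mul y a).
Proof.
move=> a0 xy; have yx : le 0 (y - x) by apply: (le_shift xy); lin.
by apply: (le_shift (mul_ge0 bla yx a0)); rewrite !mulE; lin.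
Qed.

(** Expanding (|x| - x)(|y| + y) + (|x| + x)(|y| - y) >= 0 gives 2 (|x||y| - xy) >= 0; pairing equal
    signs instead gives the bound on -xy. *)
Lemma abs_mul x y : le (labs (mul x y)) (mul (labs x) (labs y)).
Proof.
have a1 : le 0 (labs x - x) by apply: (le_shift (le_abs x)); lin.
have a2 : le 0 (labs x + x) by apply: (le_shift (leN_abs x)); lin.
have b1 : le 0 (labs y - y) by apply: (le_shift (le_abs y)); lin.
have b2 : le 0 (labs y + y) by apply: (le_shift (leN_abs y)); lin.
apply: abs_le; apply: (@leZI 2) => //.
  by apply: (le_shift (leD (mul_ge0 bla a1 b2) (mul_ge0 bla a2 b1)));
    rewrite !mulE; lin.
by apply: (le_shift (leD (mul_ge0 bla a1 b1) (mul_ge0 bla a2 b2)));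
  rewrite !mulE; lin.
Qed.

(* Write e = p - n with p, n the positive and negative parts.  The powers of
   p = e + n dominate e + k n while having norm at most 1; hence n = 0. *)
Lemma one_ge0 : le 0 e.
Proof.
pose n := pos_part (- e); have n0 : le 0 n by exact: pos_ge0.
have pE : pos_part e = e + n by rewrite {2}(pos_partE e) /n; lin.
have p0 := pos_ge0 e; have n1 : `|pos_part e| <= 1.
  rewrite -(norm_e1 bla) -(norm_abs e); apply: ge0_le_norm => //.
  exact: pos_le_abs.
pose q k := iter k (mul (pos_part e)) e.
have qle k : le (e + k%:R *: n) (q k) /\ `|q k| <= 1.
  elim: k => [|k [IH1 IH2]].
    by rewrite scale0r addr0 (norm_e1 bla); split => //; exact: vle_refl.
  split; last first.
    apply: (le_trans (mul_norm bla _ _)).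
    by rewrite -[leRHS]mulr1 ler_pM.
  rewrite /= -/(q k) {1}pE !mulE.
  have k0 : (0 : R) <= k%:R by [].
  (* p q = q + n q, and n q >= n + k n^2 because q >= e + k n; the term k n^2 >= 0 is then
     dropped. *)
  have := leD IH1 (leD (le_mul2l n0 IH1) (leN (leZ k0 (mul_ge0 bla n0 n0)))).
  by rewrite !mulE scaler0 => h; apply: (le_shift h); rewrite -natr1; lin.
suff n00 : n = 0 by move: p0; rewrite pE n00 addr0.
apply/normr0_eq0/eqP; rewrite eq_le normr_ge0 andbT leNgt; apply/negP => ngt0.
have bnd k : k%:R * `|n| <= 2.
  have [h1 h2] := qle k.
  have -> : k%:R * `|n| = `|k%:R *: n| by rewrite normrZ ger0_norm.
  have k0 : (0 : R) <= k%:R by [].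
  apply: (@le_trans _ _ `|q k - e|).
    rewrite -(norm_abs (q k - e)); apply: ge0_le_norm; first exact: scale_ge0.
    by apply: vle_trans (le_abs _); apply: (le_shift h1); lin.
  by apply: (le_trans (ler_normB _ _)); rewrite (norm_e1 bla); lra.
have := bnd (Num.bound (2 / `|n|)); rewrite -ler_pdivlMr// leNgt => /negP; apply.
by apply: archi_boundP; apply: divr_ge0.
Qed.

(** From b <= l e follows ab <= l a, and from a <= l e follows ab <= l b; the two bounds are
    disjoint. *)
Lemma disjoint_mul_eq0 a b (l : R) : le 0 a -> le 0 b ->
  le a (l *: e) -> le b (l *: e) -> disjoint_elt a b -> mul a b = 0.
Proof.
move=> a0 b0 al bl ab; apply: vle_anti; last exact: (mul_ge0 bla).
apply: (disjoint_scale (l := l) (m := l) a0 b0 ab).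
  by have := le_mul2l a0 bl; rewrite !mulE.
by have := le_mul2r b0 al; rewrite !mulE.
Qed.

(* For g = (x - m e)^+ with m > |x| one has x g = m g + g^2 >= m g, so g = 0. *)
Lemma le_norm_one x (l : R) : le 0 x -> le x (l *: e) -> le x (`|x| *: e).
Proof.
move=> x0 xl; apply: (@le_archimedean _ _ e) => eps eps0.
pose m := `|x| + eps; pose y := x - m *: e; pose g := pos_part y.
have e0 := one_ge0; have m0 : 0 < m by rewrite /m ltr_wpDl.
have me0 : le 0 (m *: e) by apply: scale_ge0 => //; exact: ltW.
have g0 : le 0 g := pos_ge0 y.
have gx : le g x by apply: pos_le => //; apply: (le_shift me0); rewrite /y; lin.
have hx : le (pos_part (- y)) (m *: e).
  by apply: pos_le => //; apply: (le_shift x0); rewrite /y; lin.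
(* Both factors lie below a multiple of e, y^- because x >= 0 and g because g <= x. Their product
   vanishes, so g^2 = y g. *)
have ge : mul (pos_part (- y)) g = 0.
  apply: (@disjoint_mul_eq0 _ _ (`|l| + m)) => //; first exact: pos_ge0.
  - by apply: vle_trans hx _; apply: leZl => //; rewrite lerDr.
  - apply: vle_trans gx _; apply: vle_trans xl _; apply: leZl => //.
    by move: (ler_norm l); lra.
  - by apply: disjointC; exact: disjoint_pos.
have h : le (m *: g) (mul x g).
  apply: (le_shift (mul_ge0 bla g0 g0)).
  have -> : mul g g = mul y g by rewrite (pos_partE y) !mulE ge -/g; lin.
  by rewrite /y !mulE; lin.
suff g00 : g = 0.
  have := le_pos y; rewrite -/g g00 => k; apply: (le_shift k).
  by rewrite /y /m; lin.
apply/normr0_eq0/eqP; rewrite eq_le normr_ge0 andbT leNgt; apply/negP => ngt0.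
have := ge0_le_norm (scale_ge0 (ltW m0) g0) h; rewrite normrZ gtr0_norm// => k.
have := le_trans k (mul_norm bla _ _).
by rewrite ler_pM2r// /m; lra.
Qed.

Lemma abs_le_norm_one x (l : R) :
  le (labs x) (l *: e) -> le (labs x) (`|x| *: e).
Proof. by rewrite -(norm_abs x); apply: le_norm_one; exact: abs_ge0. Qed.

Lemma norm_le_of_abs x (l : R) : 0 <= l -> le (labs x) (l *: e) -> `|x| <= l.
Proof. by move=> l0 /le_norm; rewrite normrZ (norm_e1 bla) mulr1 ger0_norm. Qed.

(* The projection of a >= 0 is the meet of a and |a| e: by le_norm_one, the
   meets of a and l e do not increase beyond l = |a|. *)
Lemma band_decomposition_pos a : le 0 a ->
  exists p q, [/\ le 0 p, le p (`|a| *: e), le 0 q, disjoint_elt e q & a = p + q].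
Proof.
move=> a0; have e0 := one_ge0.
exists (lmeet a (`|a| *: e)), (a - lmeet a (`|a| *: e)).
set p := lmeet _ _.
have p0 : le 0 p by apply: le_meet => //; exact: scale_ge0.
have q0 : le 0 (a - p) by apply: (le_shift (meet_lel a (`|a| *: e))); rewrite -/p; lin.
split => //; [exact: meet_ler| |by lin].
move=> z ze zq; apply: vle_trans (le_pos z) _.
set y := pos_part z; have y0 : le 0 y := pos_ge0 z.
have ye : le y e by exact: pos_le.
have yq : le y (a - p) by exact: pos_le.
have h1 : le (y + p) a by apply: (le_shift yq); lin.
have h2 : le (y + p) ((1 + `|a|) *: e).
  by apply: (le_shift (leD ye (meet_ler a (`|a| *: e)))); rewrite -/p; lin.
have h0 := add_ge0 y0 p0.
(* By [h2] the sum lies in A_e and by [h1] its norm is at most |a|, so it is already below |a| e,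
   hence below the meet p. *)
have h3 : le (y + p) (`|a| *: e).
  apply: vle_trans (le_norm_one h0 h2) _; apply: leZl => //.
  exact: ge0_le_norm.
by apply: (le_shift (le_meet h1 h3)); rewrite -/p; lin.
Qed.


(** * The modulus and the ideal A_e *)

(** The finite subcover argument as an induction principle. If [P K] failed, the sets U with P (K \
    U) would form a proper filter containing K, and the local hypothesis fails at any of its cluster
    points in K. *)
Lemma compact_induction (T : topologicalType) (K : set T) (P : set T -> Prop) :
  compact K -> P set0 ->
  (forall U V, U `<=` V -> P V -> P U) ->
  (forall U V, P U -> P V -> P (U `|` V)) ->
  (forall x, K x -> exists2 U, nbhs x U & P U) -> P K.
Proof.
move=> cK P0 PS PU Ploc; apply: contrapT => nPK.
pose F : set_system T := [set U | P (K `\` U)].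
have FF : ProperFilter F.
  split; first by rewrite /F /= setD0.
  split.
  - by rewrite /F /= setDT.
  - move=> U V FU FV; apply: PS (PU _ _ FU FV) => x [Kx nUV].
    by have [Ux|nUx] := pselect (U x); [right; split=> // Vx; apply: nUV|left].
  - by move=> U V UV; apply: PS => x [Kx nVx]; split=> // /UV.
have FK : F K by rewrite /F /= setDv.
have [x [Kx clx]] := cK _ FF FK.
have [U nU PU'] := Ploc x Kx.
have FnU : F (~` U) by apply: PS PU' => y [_ /contrapT].
by have [y [nUy Uy]] := clx _ _ FnU nU.
Qed.

Lemma cauchy_limit (s : nat -> A) (c : R) :
  (forall n m, `|s n - s m| <= c * (n.+1%:R^-1 + m.+1%:R^-1)) ->
  exists l, forall eps : R, 0 < eps ->
    exists N, forall n, (N <= n)%N -> `|s n - l| <= eps.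
Proof.
move=> h; have c0 : 0 <= c.
  have := h 0%N 0%N; rewrite subrr normr0 invr1 => h0.
  by have : 0 <= c * 2 by []; lra.
have small (eps : R) : 0 < eps ->
    exists N, forall n, (N <= n)%N -> c * n.+1%:R^-1 < eps.
  move=> e0; exists (Num.bound (c / eps)) => n Nn.
  rewrite ltr_pdivrMr// mulrC -ltr_pdivrMr//.
  apply: (@lt_le_trans _ _ (Num.bound (c / eps))%:R).
    by apply: archi_boundP; apply: divr_ge0 => //; exact: ltW.
  by rewrite ler_nat; apply: leq_trans Nn _.
have cs : cvg (s @ \oo).
  apply: cauchy_cvg; apply/cauchy_ballP => eps e0.
  have [N hN] := small (eps / 2) (divr_gt0 e0 (ltr0Sn _ _)).
  pose S := s @` [set n | (N <= n)%N]; exists (S, S).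
    by split; exists N => // n Nn; exists n.
  move=> _ /= [[n Nn <-] [m Nm <-]]; rewrite -ball_normE /=.
  apply: le_lt_trans (h n m) _; rewrite mulrDr.
  by rewrite [ltRHS]splitr ltrD// hN.
exists (lim (s @ \oo)) => eps e0.
have /cvgrPdist_le /(_ _ e0) [N _ hN] := cs.
by exists N => n Nn; rewrite distrC; exact: hN.
Qed.

(** Two approximants for eps and eps' differ by at most (eps + eps') |u|, since each lies below the
    upper bound built from the other. Approximants for 1/(n+1) are therefore Cauchy, and both
    defining properties of a supremum pass to the limit because the cone is closed. *)
Lemma lub_exists (S : set A) (u : A) :
  (forall eps : R, 0 < eps -> exists2 s,
     (forall b, (forall a, S a -> le a b) -> le s b) &
     (forall a, S a -> le a (s + eps *: u))) ->
  exists m, is_lub le S m.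
Proof.
move=> happ; have inv0 n : (0 : R) < n.+1%:R^-1 by rewrite invr_gt0.
have /choice [s hs] : forall n, exists s,
    (forall b, (forall a, S a -> le a b) -> le s b) /\
    (forall a, S a -> le a (s + n.+1%:R^-1 *: labs u)).
  move=> n; have [s h1 h2] := happ _ (inv0 n); exists s; split=> // a Sa.
  apply: vle_trans (h2 _ Sa) _; apply: leD; first exact: vle_refl.
  by apply: leZ (le_abs u); exact: ltW.
have hle n m : le (s n) (s m + m.+1%:R^-1 *: labs u).
  by apply: (hs n).1; exact: (hs m).2.
have hc n m : `|s n - s m| <= `|labs u| * (n.+1%:R^-1 + m.+1%:R^-1).
  have p0 : 0 <= n.+1%:R^-1 + m.+1%:R^-1 :> R by rewrite addr_ge0// ltW.
  rewrite mulrC -(ger0_norm p0) -normrZ; apply: le_norm.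
  have pm := scale_ge0 (ltW (inv0 m)) (abs_ge0 u).
  have pn := scale_ge0 (ltW (inv0 n)) (abs_ge0 u).
  apply: abs_le.
    by apply: (le_shift (leD (hle n m) pn)); lin.
  by apply: (le_shift (leD (hle m n) pm)); lin.
have [l hl] := cauchy_limit hc.
exists l; split=> [a Sa|b hb].
  suff k : le (a - l) 0 by apply: (le_shift k); lin.
  apply: le0_approx => eps e0.
  have u1 : 0 < `|labs u| + 1 by apply: ltr_wpDl.
  have [N hN] := hl (eps / 2) (divr_gt0 e0 (ltr0Sn _ _)).
  pose M := Num.bound (2 * (`|labs u| + 1) / eps).
  pose n := maxn N M.
  exists ((s n - l) + n.+1%:R^-1 *: labs u).
    by apply: (le_shift ((hs n).2 _ Sa)); lin.
  have d1 := hN n (leq_maxl _ _).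
  have d2 : n.+1%:R^-1 * `|labs u| <= eps / 2.
    rewrite mulrC ler_pdivrMr//.
    have : 2 * (`|labs u| + 1) / eps < n.+1%:R.
      apply: (@lt_le_trans _ _ M%:R).
        by apply: archi_boundP; apply: divr_ge0; [lra|exact: ltW].
      by rewrite ler_nat; apply: leq_trans (leq_maxr N M) _.
    by rewrite ltr_pdivrMr// => d3; lra.
  apply: le_trans (ler_normD _ _) _; rewrite normrZ gtr0_norm//.
  by rewrite [leRHS]splitr lerD.
suff k : le (l - b) 0 by apply: (le_shift k); lin.
apply: le0_approx => eps e0; have [N hN] := hl eps e0.
exists (l - s N); last by rewrite distrC; exact: hN.
by have k := (hs N).1 b hb; apply: (le_shift k); lin.
Qed.

Definition circle_set (z : cplx A) : set A :=
  [set cos t *: z.1 + sin t *: z.2 | t in [set t : R | 0 <= t <= 2 * pi]].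

Lemma circle_lub_exists z : exists m, is_lub le (circle_set z) m.
Proof.
pose u := labs z.1 + labs z.2; apply: (@lub_exists _ u) => eps e0.
(* The lower condition refers to the whole circle and the upper one only to the angles in U, so
   joins of witnesses serve unions. *)
pose P (U : set R) := exists2 s,
  (forall b, (forall a, circle_set z a -> le a b) -> le s b) &
  (forall t, U t -> 0 <= t <= 2 * pi ->
     le (cos t *: z.1 + sin t *: z.2) (s + eps *: u)).
have u0 : le 0 u by apply: add_ge0; exact: abs_ge0.
have pi0 : 0 <= 2 * pi :> R by rewrite mulr_ge0// pi_ge0.
suff [s h1 h2] : P `[0, 2 * pi]%classic.
  by exists s => // _ [t tI <-]; apply: h2 => //=; rewrite in_itv.
apply: compact_induction; first exact: segment_compact.
- exists (cos 0 *: z.1 + sin 0 *: z.2) => // b; apply.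
  by exists 0 => //=; rewrite lexx.
- by move=> U V UV [s h1 h2]; exists s => // t /UV; exact: h2.
- move=> U V [s h1 h2] [s' h1' h2']; exists (join s s').
    by move=> b hb; apply: join_le; [exact: h1|exact: h1'].
  move=> t [Ut|Vt] tI.
    by apply: vle_trans (h2 t Ut tI) _; apply: leD; [exact: le_joinl|exact: vle_refl].
  by apply: vle_trans (h2' t Vt tI) _; apply: leD; [exact: le_joinr|exact: vle_refl].
- move=> t; rewrite /= in_itv /= => tI.
  exists [set t' : R | `|cos t - cos t'| <= eps /\ `|sin t - sin t'| <= eps].
    apply: filterI.
      by have /cvgrPdist_le /(_ _ e0) := @continuous_cos R t.
    by have /cvgrPdist_le /(_ _ e0) := @continuous_sin R t.
  exists (cos t *: z.1 + sin t *: z.2); first by move=> b; apply; exists t.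
  move=> t' [ct st] _.
  rewrite distrC in ct; rewrite distrC in st.
  have k1 := vle_trans (le_abs _) (absZ_le z.1 ct).
  have k2 := vle_trans (le_abs _) (absZ_le z.2 st).
  by apply: (le_shift (leD k1 k2)); rewrite /u; lin.
Qed.

Local Notation modc := (cxmod le).

(** Existence of the supremum rules out the default branch of [xget]; from here on only the
    universal property is used. *)
Lemma cxmod_lub z : is_lub le (circle_set z) (modc z).
Proof.
have /cid [m hm] := circle_lub_exists z.
by rewrite /cxmod; case: xgetP => [y _ //|/(_ m)].
Qed.

Lemma cxmod_ge z t : 0 <= t <= 2 * pi ->
  le (cos t *: z.1 + sin t *: z.2) (modc z).
Proof. by move=> tI; apply: (cxmod_lub z).1; exists t. Qed.

Lemma cxmod_le z m :
  (forall t, 0 <= t <= 2 * pi -> le (cos t *: z.1 + sin t *: z.2) m) ->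
  le (modc z) m.
Proof. by move=> h; apply: (cxmod_lub z).2 => _ [t tI <-]; exact: h. Qed.

Lemma abs_re_le_cxmod z : le (labs z.1) (modc z).
Proof.
have p0 := pi_ge0 R; apply: abs_le.
  have := @cxmod_ge z 0; rewrite cos0 sin0 scale1r scale0r addr0; apply.
  by apply/andP; split; lra.
have := @cxmod_ge z pi; rewrite cospi sinpi scaleN1r scale0r addr0; apply.
by apply/andP; split; lra.
Qed.

Lemma abs_im_le_cxmod z : le (labs z.2) (modc z).
Proof.
have p0 := pi_ge0 R; apply: abs_le.
  have := @cxmod_ge z (pi / 2).
  rewrite cos_pihalf sin_pihalf scale1r scale0r add0r; apply.
  by apply/andP; split; lra.
(* The angle 3 pi / 2, written so that the shift by pi applies. *)
have := @cxmod_ge z (pi / 2 + pi).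
rewrite cosDpi sinDpi cos_pihalf sin_pihalf scaleN1r oppr0 scale0r add0r; apply.
by apply/andP; split; lra.
Qed.

Lemma cxmod_le_abs z : le (modc z) (labs z.1 + labs z.2).
Proof.
apply: cxmod_le => t _; apply: leD.
  apply: vle_trans (le_abs _) _; rewrite -[labs z.1]scale1r; apply: absZ_le.
  by rewrite ler_norml cos_geN1 cos_le1.
apply: vle_trans (le_abs _) _; rewrite -[labs z.2]scale1r; apply: absZ_le.
by rewrite ler_norml sin_geN1 sin_le1.
Qed.

Lemma cxmod_ge0 z : le 0 (modc z).
Proof. exact: vle_trans (abs_ge0 _) (abs_re_le_cxmod z). Qed.

Local Notation Ae := (Ae le join e).
Local Notation ACe := (ACe le e).

Lemma AeP x : Ae x <-> le (labs x) (`|x| *: e).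
Proof.
split=> [[l [_ xl]]|xl]; first exact: abs_le_norm_one xl.
by exists `|x|.
Qed.

Lemma Ae_solid x y : le (labs x) (labs y) -> Ae y -> Ae x.
Proof. by move=> xy [l [l0 yl]]; exists l; split => //; exact: vle_trans yl. Qed.

Lemma Ae_ge0 x (l : R) : le 0 x -> le x (l *: e) -> Ae x.
Proof.
move=> x0 xl; exists `|l|; split=> //; rewrite ge0_abs//.
by apply: vle_trans xl _; apply: leZl; [exact: one_ge0|exact: ler_norm].
Qed.

Lemma Ae_add x y : Ae x -> Ae y -> Ae (x + y).
Proof.
move=> [l [l0 xl]] [m [m0 ym]]; exists (l + m); split; first exact: addr_ge0.
by apply: vle_trans (absD x y) _; apply: (le_shift (leD xl ym)); lin.
Qed.

Lemma Ae_scale (a : R) x : Ae x -> Ae (a *: x).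
Proof.
move=> [l [l0 xl]]; exists (`|a| * l); split; first exact: mulr_ge0.
by rewrite absZ -scalerA; exact: leZ.
Qed.

Lemma Ae_opp x : Ae x -> Ae (- x).
Proof. by rewrite -scaleN1r; exact: Ae_scale. Qed.

Lemma Ae_sub x y : Ae x -> Ae y -> Ae (x - y).
Proof. by move=> xA yA; apply: Ae_add => //; exact: Ae_opp. Qed.

Lemma Ae_abs x : Ae x -> Ae (labs x).
Proof. by apply: Ae_solid; rewrite (ge0_abs (abs_ge0 x)); exact: vle_refl. Qed.

Lemma Ae_one : Ae e.
Proof. by apply: (@Ae_ge0 _ 1); [exact: one_ge0|rewrite scale1r; exact: vle_refl]. Qed.

Lemma Ae0 : Ae 0.
Proof. by rewrite -(scale0r e); apply: Ae_scale; exact: Ae_one. Qed.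

Lemma Ae_mul x y : Ae x -> Ae y -> Ae (mul x y).
Proof.
move=> [l [l0 xl]] [m [m0 ym]]; exists (l * m); split; first exact: mulr_ge0.
apply: vle_trans (abs_mul x y) _.
apply: vle_trans (le_mul2r (abs_ge0 y) xl) _.
by rewrite !mulE -scalerA; exact: leZ.
Qed.

(** The modulus lies above |x| and |y| and below |x| + |y|. *)
Lemma ACeE : ACe = [set z | Ae z.1 /\ Ae z.2].
Proof.
apply/seteqP; split=> z /=.
  move=> [l [l0 zl]]; split; exists l; split=> //.
    exact: vle_trans (abs_re_le_cxmod z) zl.
  exact: vle_trans (abs_im_le_cxmod z) zl.
move=> [[l [l0 zl]] [m [m0 zm]]]; exists (l + m); split; first exact: addr_ge0.
by apply: vle_trans (cxmod_le_abs z) _; apply: (le_shift (leD zl zm)); lin.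
Qed.

Lemma ACe_cxmod z : ACe z -> Ae (modc z).
Proof. by move=> [l [l0 zl]]; apply: Ae_ge0 zl; exact: cxmod_ge0. Qed.

Lemma inf_order_unit x : le 0 x -> Ae x ->
  inf [set l : R | 0 < l /\ le x (l *: e)] = `|x|.
Proof.
move=> x0 /AeP; rewrite ge0_abs// => xn; have e0 := one_ge0.
(* The strict bound [0 < l] excludes the norm itself when x = 0, so the infimum is approached from
   above. *)
have hle (eps : R) : 0 < eps -> 0 < `|x| + eps /\ le x ((`|x| + eps) *: e).
  move=> eps0; split; first exact: ltr_wpDl.
  by apply: vle_trans xn _; apply: leZl => //; rewrite lerDl ltW.
apply/eqP; rewrite eq_le; apply/andP; split.
  apply/ler_addgt0Pl => eps eps0; rewrite addrC; apply: ge_inf; last exact: hle.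
  by exists 0 => l [/ltW].
apply: lb_le_inf; first by exists (`|x| + 1); exact: hle.
by move=> l [/ltW l0 xl]; apply: norm_le_of_abs => //; rewrite ge0_abs.
Qed.

(** * The band generated by e *)

Lemma disjoint_abs_add u x y : le 0 u -> disjoint_elt u (labs x) ->
  disjoint_elt u (labs y) -> disjoint_elt u (labs (x + y)).
Proof.
move=> u0 ux uy; apply: (@disjoint_le u (labs x + labs y)).
- exact: vle_refl.
- exact: absD.
- by apply: disjointD => //; exact: abs_ge0.
Qed.

(** |x| lies below both l e and itself, and these two are disjoint. *)
Lemma disjoint_one_eq0 x : Ae x -> disjoint_elt e (labs x) -> x = 0.
Proof.
move=> [l [l0 xl]] ex; apply/normr0_eq0; rewrite -norm_abs.
suff -> : labs x = 0 by rewrite normr0.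
apply: vle_anti; last exact: abs_ge0.
have e0 := one_ge0; have a0 := abs_ge0 x.
apply: (disjoint_scale (l := l) (m := 1) e0 a0 ex) => //.
by rewrite scale1r; exact: vle_refl.
Qed.

Lemma band_decomposition a :
  exists p q, [/\ Ae p, disjoint_elt e (labs q) & a = p + q].
Proof.
have [p [q [p0 pl q0 eq apq]]] := band_decomposition_pos (pos_ge0 a).
have [p' [q' [p0' pl' q0' eq' apq']]] := band_decomposition_pos (pos_ge0 (- a)).
exists (p - p'), (q - q'); split.
- by apply: Ae_sub; apply: Ae_ge0; eassumption.
- apply: disjoint_abs_add; first exact: one_ge0.
    by rewrite ge0_abs.
  by rewrite absN ge0_abs.
- by rewrite {1}(pos_partE a) apq apq'; lin.
Qed.

Lemma disjoint_one_mul b q : Ae b -> disjoint_elt e (labs q) ->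
  disjoint_elt e (labs (mul b q)).
Proof.
move=> [l [l0 bl]] eq; have e0 := one_ge0; have q0 := abs_ge0 q.
have := disjoint_scale (l := 1) (m := l) e0 q0 eq; rewrite scale1r.
apply: disjoint_le; first exact: vle_refl.
apply: vle_trans (abs_mul b q) _; apply: vle_trans (le_mul2r q0 bl) _.
by rewrite !mulE; exact: vle_refl.
Qed.

(** Testing against e alone suffices, since every |w| is below a multiple of e; |v| is then compared
    with |v.1| and |v.2|. *)
Lemma disjoint_complP v : disjoint_compl le join ACe v <->
  disjoint_elt e (labs v.1) /\ disjoint_elt e (labs v.2).
Proof.
have e0 := one_ge0; split=> [h|[h1 h2] w [l [l0 wl]]].
  have ee : ACe (e, 0) by rewrite ACeE; split; [exact: Ae_one|exact: Ae0].
  have /disjoint_meet k := h _ ee.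
  have {}k := k (cxmod_ge0 _) (cxmod_ge0 _).
  have el := abs_re_le_cxmod (e, 0); rewrite ge0_abs//= in el.
  split; apply: disjoint_le k => //; [exact: abs_re_le_cxmod|exact: abs_im_le_cxmod].
apply/disjoint_meet; [exact: cxmod_ge0|exact: cxmod_ge0|].
have q0 : le 0 (labs v.1 + labs v.2) by apply: add_ge0; exact: abs_ge0.
have k : disjoint_elt e (labs v.1 + labs v.2).
  by apply: disjointD => //; exact: abs_ge0.
have := disjoint_scale (l := l) (m := 1) e0 q0 k; rewrite scale1r.
by apply: disjoint_le => //; exact: cxmod_le_abs.
Qed.

(* Writing w = w' + w'' along the band decomposition, b w'' is both in A_e and
   disjoint from it, so it vanishes, and then w'' = w b w'' = 0. *)
Lemma ACe_inverse_closed b w : ACe b -> cxmul mul b w = cxone e ->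
  cxmul mul w b = cxone e -> ACe w.
Proof.
rewrite ACeE => -[b1 b2] [bw1 bw2] [wb1 wb2].
have e0 := one_ge0.
have [p1 [q1 [Ap1 dq1 w1E]]] := band_decomposition w.1.
have [p2 [q2 [Ap2 dq2 w2E]]] := band_decomposition w.2.
have r1 : mul b.1 q1 - mul b.2 q2 = 0.
  apply: disjoint_one_eq0.
    have -> : mul b.1 q1 - mul b.2 q2 = e - (mul b.1 p1 - mul b.2 p2).
      by rewrite -bw1 w1E w2E !mulE; lin.
    by apply: Ae_sub; [exact: Ae_one|apply: Ae_sub; exact: Ae_mul].
  apply: disjoint_abs_add => //; first exact: disjoint_one_mul.
  by rewrite absN; exact: disjoint_one_mul.
have r2 : mul b.1 q2 + mul b.2 q1 = 0.
  apply: disjoint_one_eq0.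
    have -> : mul b.1 q2 + mul b.2 q1 = - (mul b.1 p2 + mul b.2 p1).
      apply/eqP; rewrite -addr_eq0; apply/eqP.
      by rewrite -[RHS]bw2 w1E w2E !mulE; lin.
    by apply: Ae_opp; apply: Ae_add; exact: Ae_mul.
  by apply: disjoint_abs_add => //; exact: disjoint_one_mul.
have z1 : q1 = 0.
  have -> : q1 = mul w.1 (mul b.1 q1 - mul b.2 q2)
               - mul w.2 (mul b.1 q2 + mul b.2 q1).
    rewrite !mulE !(mulA' bla).
    have k : q1 = mul (mul w.1 b.1 - mul w.2 b.2) q1
                 - mul (mul w.1 b.2 + mul w.2 b.1) q2.
      by rewrite wb1 wb2 !mulE; lin.
    by rewrite [LHS]k !mulE; lin.
  by rewrite r1 r2 !mulE subr0.
have z2 : q2 = 0.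
  have -> : q2 = mul w.1 (mul b.1 q2 + mul b.2 q1)
               + mul w.2 (mul b.1 q1 - mul b.2 q2).
    rewrite !mulE !(mulA' bla).
    have k : q2 = mul (mul w.1 b.1 - mul w.2 b.2) q2
                 + mul (mul w.1 b.2 + mul w.2 b.1) q1.
      by rewrite wb1 wb2 !mulE; lin.
    by rewrite [LHS]k !mulE; lin.
  by rewrite r1 r2 !mulE addr0.
by rewrite /= w1E w2E z1 z2 !addr0.
Qed.

(** * Maximal ideals and characters *)

(* A character is defined on A_e only; it is extended by 0 so that characters
   are determined pointwise on A. *)
Record character (phi : A -> R) : Prop := {
  char_out : forall x, ~ Ae x -> phi x = 0;
  char_add : forall x y, Ae x -> Ae y -> phi (x + y) = phi x + phi y;
  char_scale : forall (a : R) x, Ae x -> phi (a *: x) = a * phi x;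
  char_mul : forall x y, Ae x -> Ae y -> phi (mul x y) = phi x * phi y;
  char_abs : forall x, Ae x -> phi (labs x) = `|phi x|;
  char_one : phi e = 1
}.

Lemma abs_sub_abs x y : le (labs (labs x - labs y)) (labs (x - y)).
Proof.
apply: abs_le.
  have := absD (x - y) y; have -> : x - y + y = x by lin.
  by move=> h; apply: (le_shift h); lin.
have := absD (y - x) x; have -> : y - x + x = y by lin.
have -> : y - x = - (x - y) by lin.
by rewrite absN => h; apply: (le_shift h); lin.
Qed.

Lemma scale_one_ge0 (c : R) : le 0 (c *: e) -> 0 <= c.
Proof.
move=> h; rewrite leNgt; apply/negP => c0.
have ce : c *: e = 0.
  apply: vle_anti => //; rewrite -[0](scale0r e).
  by apply: leZl; [exact: one_ge0|exact: ltW].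
have := congr1 (fun x : A => `|x|) ce.
by rewrite normrZ (norm_e1 bla) normr0 mulr1 => /eqP; rewrite normr_eq0 lt_eqF.
Qed.

Section MaximalIdeal.
Variable u : A.
Hypothesis u0 : le 0 u.
Hypothesis u_not_unit : forall l : R, 0 <= l -> ~ le e (l *: u).

(* The last clause makes the empty set, the union of the empty chain, a legal
   member while forcing every other member to contain u. *)
Definition proper_ideal (I : set A) : Prop :=
  [/\ forall x y, I x -> I y -> I (x + y),
      forall (a : R) x, I x -> I (a *: x),
      forall x y, I x -> le (labs y) (labs x) -> I y,
      ~ I e & forall x, I x -> I u].

Lemma maximal_ideal_exists :
  exists2 M, proper_ideal M & M u /\ forall B, M `<` B -> ~ proper_ideal B.
Proof.
have [|M [PM maxM]] := @Zorn_bigcup A proper_ideal.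
  move=> F PF Ft; split.
  - move=> x y [I FI Ix] [J FJ Jy].
    have [aI _ _ _ _] := PF I FI; have [aJ _ _ _ _] := PF J FJ.
    by have [IJ|JI] := Ft I J FI FJ; [exists J|exists I]; auto.
  - move=> a x [I FI Ix]; exists I => //.
    by have [_ sI _ _ _] := PF I FI; exact: sI.
  - move=> x y [I FI Ix] yx; exists I => //.
    by have [_ _ sI _ _] := PF I FI; exact: sI yx.
  - by move=> [I FI Ie]; have [_ _ _ nI _] := PF I FI; exact: nI.
  - move=> x [I FI Ix]; exists I => //.
    by have [_ _ _ _ uI] := PF I FI; exact: uI Ix.
exists M => //; split=> //.
have [_ _ _ _ uM] := PM.
have [[x Mx]|M0] := pselect (exists x, M x); first exact: uM Mx.
(* Should the maximal member be empty, the order ideal generated by u, which misses e by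
   [u_not_unit], would strictly extend it. *)
exfalso; apply: (maxM [set v | exists l : R, 0 <= l /\ le (labs v) (l *: u)]).
  split=> [x Mx|]; first by exfalso; apply: M0; exists x.
  move/(_ 0) => h; apply: M0; exists 0; apply: h; exists 0; split=> //.
  by rewrite scale0r ge0_abs; exact: vle_refl.
split.
- move=> x y [l [l0 xl]] [m [m0 ym]]; exists (l + m); split; first exact: addr_ge0.
  by apply: vle_trans (absD x y) _; apply: (le_shift (leD xl ym)); lin.
- move=> a x [l [l0 xl]]; exists (`|a| * l); split; first exact: mulr_ge0.
  by rewrite absZ -scalerA; exact: leZ.
- by move=> x y [l [l0 xl]] yx; exists l; split=> //; exact: vle_trans xl.
- move=> [l [l0]]; rewrite ge0_abs; last exact: one_ge0.
  exact: u_not_unit.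
- move=> x _; exists 1; split=> //; rewrite ge0_abs// scale1r.
  exact: vle_refl.
Qed.

Variable M : set A.
Hypothesis PM : proper_ideal M.
Hypothesis Mu : M u.
Hypothesis maxM : forall B, M `<` B -> ~ proper_ideal B.

Lemma idealD x y : M x -> M y -> M (x + y).
Proof. by case: PM => h _ _ _ _; exact: h. Qed.

Lemma idealZ (a : R) x : M x -> M (a *: x).
Proof. by case: PM => _ h _ _ _; exact: h. Qed.

Lemma ideal_solid x y : M x -> le (labs y) (labs x) -> M y.
Proof. by case: PM => _ _ h _ _; exact: h. Qed.

Lemma ideal_proper : ~ M e.
Proof. by case: PM. Qed.

Lemma ideal_ge0_le x y : le 0 y -> le y x -> M x -> M y.
Proof.
move=> y0 yx Mx; apply: ideal_solid Mx _; rewrite ge0_abs//.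
exact: vle_trans yx (le_abs x).
Qed.

Lemma ideal_abs x : M x -> M (labs x).
Proof.
by move=> Mx; apply: ideal_solid Mx _; rewrite (ge0_abs (abs_ge0 x)); exact: vle_refl.
Qed.

Lemma ideal0 : M 0.
Proof. by rewrite -(scale0r u); exact: idealZ. Qed.

Lemma ideal_mulr x y : M x -> Ae y -> M (mul x y).
Proof.
move=> Mx [l [l0 yl]]; apply: (ideal_solid (idealZ l Mx)).
apply: vle_trans (abs_mul x y) _; rewrite absZ ger0_norm//.
by have := le_mul2l (abs_ge0 x) yl; rewrite !mulE.
Qed.

(** The order ideal generated by M and a strictly contains M, so by maximality it contains e. *)
Lemma maximal_ideal_unit a : le 0 a -> ~ M a ->
  exists i (l : R), [/\ M i, 0 <= l & le e (i + l *: a)].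
Proof.
move=> a0 nMa; apply: contrapT => hn.
apply: (maxM (B := [set v | exists i (l : R),
    [/\ M i, 0 <= l & le (labs v) (labs i + l *: a)]])).
  split=> [x Mx|].
    by exists x, 0; split=> //; rewrite scale0r addr0; exact: vle_refl.
  move/(_ a) => h; apply: nMa; apply: h; exists 0, 1; split=> //.
    exact: ideal0.
  rewrite !ge0_abs//; last exact: vle_refl.
  by rewrite scale1r add0r; exact: vle_refl.
split.
- move=> x y [i [l [Mi l0 xi]]] [j [m [Mj m0 yj]]].
  exists (labs i + labs j), (l + m); split; last 1 first.
  + rewrite (ge0_abs (add_ge0 (abs_ge0 i) (abs_ge0 j))).
    by apply: vle_trans (absD x y) _; apply: (le_shift (leD xi yj)); lin.
  + by apply: idealD; exact: ideal_abs.
  + exact: addr_ge0.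
- move=> c x [i [l [Mi l0 xi]]]; exists (c *: i), (`|c| * l); split.
  + exact: idealZ.
  + exact: mulr_ge0.
  + have c0 : 0 <= `|c| by [].
    by rewrite !absZ; apply: (le_shift (leZ c0 xi)); lin.
- move=> x y [i [l [Mi l0 xi]]] yx; exists i, l; split=> //.
  exact: vle_trans yx xi.
- move=> [i [l [Mi l0 ei]]]; apply: hn; exists (labs i), l; split=> //.
    exact: ideal_abs.
  exact: vle_trans (le_abs e) ei.
- move=> _ _; exists u, 0; split=> //; rewrite scale0r addr0; exact: vle_refl.
Qed.

(** If both were outside M, then e <= i + l a and e <= j + m b with i, j in M. So e - |i| - |j| lies
    below the disjoint l a and m b, hence below 0, which puts e in M. *)
Lemma maximal_ideal_prime a b : le 0 a -> le 0 b -> disjoint_elt a b ->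
  ~ M a -> M b.
Proof.
move=> a0 b0 ab nMa; apply: contrapT => nMb.
have [i [l [Mi l0 ei]]] := maximal_ideal_unit a0 nMa.
have [j [m [Mj m0 ej]]] := maximal_ideal_unit b0 nMb.
apply: ideal_proper; have e0 := one_ge0.
have h : le (e - (labs i + labs j)) 0.
  apply: (disjoint_scale (l := l) (m := m) a0 b0 ab).
    by apply: (le_shift (leD (leD ei (le_abs i)) (abs_ge0 j))); lin.
  by apply: (le_shift (leD (leD ej (le_abs j)) (abs_ge0 i))); lin.
apply: (@ideal_ge0_le (labs i + labs j)) => //; last first.
  by apply: idealD; exact: ideal_abs.
by apply: (le_shift h); lin.
Qed.

(* r is the supremum of the s with (s e - x)^+ in M.  By primeness
   (x - (r + eps) e)^+ is in M as well, so |x - r e| <= eps e modulo M for all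
   eps > 0, which maximality turns into x - r e in M. *)
Lemma maximal_ideal_residue x : Ae x -> exists r : R, M (x - r *: e).
Proof.
move=> /AeP xA; have e0 := one_ge0.
pose S := [set s : R | M (pos_part (s *: e - x))].
have S0 : S !=set0.
  exists (- `|x|); suff : pos_part (- `|x| *: e - x) = 0.
    by rewrite /S /= => ->; exact: ideal0.
  apply: vle_anti; last exact: pos_ge0.
  apply: pos_le; last exact: vle_refl.
  by apply: (le_shift (vle_trans (leN_abs x) xA)); lin.
have Sub : ubound S `|x|.
  move=> s Ss; rewrite leNgt; apply/negP => sx; apply: ideal_proper.
  have d0 : 0 < s - `|x| by lra.
  have h : M ((s - `|x|) *: e).
    apply: ideal_ge0_le Ss; first by apply: scale_ge0 => //; exact: ltW.
    apply: vle_trans (le_pos _).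
    by apply: (le_shift (vle_trans (le_abs x) xA)); lin.
  have := idealZ (s - `|x|)^-1 h.
  by rewrite scalerA mulVf ?scale1r// gt_eqF.
have hS : has_sup S by split=> //; exists `|x|.
pose r := sup S; exists r.
have h1 (eps : R) : 0 < eps -> M (pos_part ((r - eps) *: e - x)).
  move=> /sup_adherent /(_ hS) [s Ss rs]; apply: ideal_ge0_le Ss.
    exact: pos_ge0.
  apply: pos_le; last exact: pos_ge0.
  apply: vle_trans (le_pos _).
  have rs' : r - eps <= s by exact: ltW.
  by apply: (le_shift (leZl e0 rs')); lin.
have h2 (eps : R) : 0 < eps -> M (pos_part (x - (r + eps) *: e)).
  move=> eps0; have y0 := pos_ge0 (x - (r + eps) *: e).
  have y0' := pos_ge0 (- (x - (r + eps) *: e)).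
  apply: (maximal_ideal_prime y0' y0).
    by apply: disjointC; exact: disjoint_pos.
  have -> : - (x - (r + eps) *: e) = (r + eps) *: e - x by lin.
  move=> Mr; have : r + eps <= r by apply: ub_le_sup => //; exists `|x|.
  by lra.
apply: (@ideal_solid (labs (x - r *: e))); last first.
  by rewrite (ge0_abs (abs_ge0 _)); exact: vle_refl.
apply: contrapT => nM.
have [i [l [Mi l0 ei]]] := maximal_ideal_unit (abs_ge0 _) nM.
(* Chosen so that l eps <= 1/2: then e <= i + l p + e/2, and e <= 2 (i + l p) lies in M. *)
pose eps := (2 * (l + 1))^-1.
have eps0 : 0 < eps by rewrite invr_gt0; lra.
have le2 : l * eps <= 2^-1.
  by rewrite /eps invfM mulrCA ler_piMr ?invr_ge0// ler_pdivrMr; lra.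
pose p := pos_part (x - (r + eps) *: e) + pos_part ((r - eps) *: e - x).
have Mp : M p by apply: idealD; [exact: h2|exact: h1].
have wp : le (labs (x - r *: e)) (p + eps *: e).
  apply: abs_le.
    apply: (le_shift (leD (le_pos (x - (r + eps) *: e))
                          (pos_ge0 ((r - eps) *: e - x)))).
    by rewrite /p; lin.
  apply: (le_shift (leD (le_pos ((r - eps) *: e - x))
                        (pos_ge0 (x - (r + eps) *: e)))).
  by rewrite /p; lin.
apply: ideal_proper.
apply: (@ideal_ge0_le (2 *: (i + l *: p))) => //.
  have two0 : (0 : R) <= 2 by [].
  have h := leD (leD ei (leZ l0 wp)) (leZl e0 le2).
  by apply: (le_shift (leZ two0 h)); lin.
by apply: idealZ; apply: idealD => //; exact: idealZ.
Qed.

Lemma residue_unique x (r s : R) : M (x - r *: e) -> M (x - s *: e) -> r = s.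
Proof.
move=> Mr Ms; apply/eqP; rewrite -subr_eq0; apply/negPn/negP => rs.
apply: ideal_proper; have := idealZ (r - s)^-1 (idealD Ms (idealZ (-1) Mr)).
suff -> : (r - s)^-1 *: (x - s *: e + -1 *: (x - r *: e)) = e by [].
have -> : x - s *: e + -1 *: (x - r *: e) = (r - s) *: e by lin.
by rewrite scalerA mulVf// scale1r.
Qed.

(** Residues are unique, so each clause only requires checking that the expected value is a
    residue. *)
Lemma residue_character : exists2 phi, character phi &
  forall x (r : R), Ae x -> M (x - r *: e) -> phi x = r.
Proof.
have /choice [phi hphi] : forall x, exists r : R,
    (Ae x -> M (x - r *: e)) /\ (~ Ae x -> r = 0).
  move=> x; have [xA|nxA] := pselect (Ae x); last by exists 0; split.
  by have [r hr] := maximal_ideal_residue xA; exists r; split.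
have hA x : Ae x -> M (x - phi x *: e) by apply: (hphi x).1.
have uniq x (r : R) : Ae x -> M (x - r *: e) -> phi x = r.
  by move=> xA; exact: residue_unique (hA x xA).
exists phi => //; split.
- by move=> x; exact: (hphi x).2.
- move=> x y xA yA; apply: uniq; first exact: Ae_add.
  have := idealD (hA x xA) (hA y yA).
  by congr (M _); lin.
- move=> a x xA; apply: uniq; first exact: Ae_scale.
  by have := idealZ a (hA x xA); congr (M _); lin.
- move=> x y xA yA; apply: uniq; first exact: Ae_mul.
  (* xy - rs e = (x - r e) y + r (y - s e), where r and s are the residues of x and y. *)
  have := idealD (ideal_mulr (hA x xA) yA) (idealZ (phi x) (hA y yA)).
  by rewrite !mulE; congr (M _); lin.
- move=> x xA; apply: uniq; first exact: Ae_abs.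
  apply: ideal_solid (hA x xA) _.
  have -> : `|phi x| *: e = labs (phi x *: e).
    by rewrite absZ ge0_abs//; exact: one_ge0.
  exact: abs_sub_abs.
- apply: uniq; first exact: Ae_one.
  by rewrite scale1r subrr; exact: ideal0.
Qed.

End MaximalIdeal.

(** For u = |y| e - y, a bound e <= l u would give l y <= (l |y| - 1) e, and taking norms l |y| <= l
    |y| - 1. Thus some maximal ideal contains u, and modulo it y is |y| e. *)
Lemma character_norming y : le 0 y -> Ae y ->
  exists2 phi, character phi & phi y = `|y|.
Proof.
move=> y0 yA; have := yA => /AeP; rewrite ge0_abs// => yn.
pose u := `|y| *: e - y.
have u0 : le 0 u by apply: (le_shift yn); rewrite /u; lin.
have [|M PM [Mu maxM]] := @maximal_ideal_exists u u0.
  move=> l l0 h; have h1 : le (l *: y) ((l * `|y| - 1) *: e).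
    by apply: (le_shift h); rewrite /u; lin.
  have ly0 := scale_ge0 l0 y0.
  have c0 : 0 <= l * `|y| - 1 by apply: scale_one_ge0; exact: vle_trans h1.
  have := ge0_le_norm ly0 h1.
  by rewrite !normrZ (norm_e1 bla) mulr1 !ger0_norm//; lra.
have [phi chi hphi] := residue_character PM Mu maxM.
exists phi => //; apply: hphi => //.
have -> : y - `|y| *: e = -1 *: u by rewrite /u; lin.
exact: (idealZ PM).
Qed.

Section CharacterTheory.
Variables (phi : A -> R) (chi : character phi).

Lemma char0 : phi 0 = 0.
Proof. by rewrite -(scale0r e) (char_scale chi) ?mul0r//; exact: Ae_one. Qed.

Lemma char_opp x : Ae x -> phi (- x) = - phi x.
Proof. by move=> xA; rewrite -scaleN1r (char_scale chi)// mulN1r. Qed.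

Lemma char_sub x y : Ae x -> Ae y -> phi (x - y) = phi x - phi y.
Proof.
by move=> xA yA; rewrite (char_add chi)// ?char_opp//; exact: Ae_opp.
Qed.

Lemma char_mono x y : Ae x -> Ae y -> le x y -> phi x <= phi y.
Proof.
move=> xA yA xy; rewrite -subr_ge0 -char_sub//.
have h : le 0 (y - x) by apply: (le_shift xy); lin.
by rewrite -(ge0_abs h) (char_abs chi)//; exact: Ae_sub.
Qed.

Lemma char_scale_one (a : R) : phi (a *: e) = a.
Proof. by rewrite (char_scale chi) ?(char_one chi) ?mulr1//; exact: Ae_one. Qed.

Lemma char_norm x : `|phi x| <= `|x|.
Proof.
have [xA|nxA] := pselect (Ae x); last by rewrite (char_out chi)// normr0.
rewrite -(char_abs chi)// -[leRHS]char_scale_one; apply: char_mono.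
- exact: Ae_abs.
- by apply: Ae_scale; exact: Ae_one.
- exact/AeP.
Qed.

End CharacterTheory.

(** x + |x| is twice the positive part of x; every character sends it to phi x + |phi x| = 0, and a
    norming one detects its norm. *)
Lemma character_separates_order x : Ae x ->
  (forall phi, character phi -> phi x <= 0) -> le x 0.
Proof.
move=> xA h; have y0 : le 0 (x + labs x) by apply: (le_shift (leN_abs x)); lin.
have yA : Ae (x + labs x) by apply: Ae_add => //; exact: Ae_abs.
have [phi chi hphi] := character_norming y0 yA.
have /normr0_eq0 y00 : `|x + labs x| = 0.
  rewrite -hphi (char_add chi) ?(char_abs chi)//; last exact: Ae_abs.
  by rewrite ler0_norm ?subrr//; exact: h.
have xE : x = - labs x by apply/eqP; rewrite -addr_eq0 y00.
by apply: (le_shift (abs_ge0 x)); rewrite [X in 0 - X]xE; lin.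
Qed.

Lemma character_le x y : Ae x -> Ae y ->
  (forall phi, character phi -> phi x <= phi y) -> le x y.
Proof.
move=> xA yA h; suff k : le (x - y) 0 by apply: (le_shift k); lin.
apply: character_separates_order; first exact: Ae_sub.
by move=> phi chi; rewrite (char_sub chi)// subr_le0; exact: h.
Qed.

(** * The Gelfand transform *)

(** The condition |x| <= ||x|| e, which characterizes A_e, is preserved by norm limits. *)
Lemma Ae_closed l : (forall eps : R, 0 < eps -> exists2 x, Ae x & `|x - l| <= eps) ->
  Ae l.
Proof.
move=> h; apply/AeP; suff k : le (labs l - `|l| *: e) 0.
  by apply: (le_shift k); lin.
apply: le0_approx => eps eps0.
have [x /AeP xA xl] := h _ (divr_gt0 eps0 (ltr0Sn _ 1)).
exists (labs (x - l) + `|x - l| *: e); last first.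
  apply: le_trans (ler_normD _ _) _.
  rewrite norm_abs normrZ (norm_e1 bla) mulr1 normr_id.
  by rewrite [leRHS]splitr lerD.
have h1 : le (labs l) (labs x + labs (x - l)).
  have := absD x (- (x - l)); have -> : x - (x - l) = l by lin.
  by rewrite absN.
have h2 : `|x| <= `|l| + `|x - l|.
  by have := ler_normD (x - l) l; rewrite subrK addrC.
have h3 := vle_trans xA (leZl one_ge0 h2).
by apply: (le_shift (leD h1 h3)); lin.
Qed.

Lemma character_eq x y : Ae x -> Ae y ->
  (forall phi, character phi -> phi x = phi y) -> x = y.
Proof.
by move=> xA yA h; apply: vle_anti; apply: character_le => // phi chi; rewrite h.
Qed.

(** Written through [labs], the lattice operation that characters preserve by definition. *)
Definition lattice_max x y : A := 2^-1 *: (x + y + labs (x - y)).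
Definition lattice_min x y : A := 2^-1 *: (x + y - labs (x - y)).

Lemma Ae_max x y : Ae x -> Ae y -> Ae (lattice_max x y).
Proof.
move=> xA yA; apply: Ae_scale; apply: Ae_add; first exact: Ae_add.
by apply: Ae_abs; exact: Ae_sub.
Qed.

Lemma Ae_min x y : Ae x -> Ae y -> Ae (lattice_min x y).
Proof.
move=> xA yA; apply: Ae_scale; apply: Ae_sub; first exact: Ae_add.
by apply: Ae_abs; exact: Ae_sub.
Qed.

Lemma char_max phi x y : character phi -> Ae x -> Ae y ->
  phi (lattice_max x y) = Num.max (phi x) (phi y).
Proof.
move=> chi xA yA; have sA := Ae_sub xA yA; have aA := Ae_abs sA.
rewrite (char_scale chi); last by apply: Ae_add => //; exact: Ae_add.
rewrite (char_add chi) ?(char_add chi xA yA)//; last exact: Ae_add.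
by rewrite (char_abs chi)// char_sub// maxr_absE mulrC.
Qed.

Lemma char_min phi x y : character phi -> Ae x -> Ae y ->
  phi (lattice_min x y) = Num.min (phi x) (phi y).
Proof.
move=> chi xA yA; have sA := Ae_sub xA yA; have aA := Ae_abs sA.
rewrite (char_scale chi); last by apply: Ae_sub => //; exact: Ae_add.
rewrite char_sub// ?(char_add chi xA yA)//; last exact: Ae_add.
by rewrite (char_abs chi)// char_sub// minr_absE mulrC.
Qed.

(** * The compact Hausdorff space of characters *)

Definition characters : set {ptws A -> R} := [set phi | character phi].
Local Notation K := (set_type characters).

Definition gelfand (x : A) (k : K) : R := (set_val k : A -> R) x.

Lemma gelfand_char (k : K) : character (set_val k : A -> R).
Proof. exact: set_valP. Qed.

Lemma char_gelfand phi : character phi ->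
  exists k : K, forall x, phi x = gelfand x k.
Proof. by move=> chi; exists (exist _ phi (mem_set chi)). Qed.

Lemma eval_continuous (x : A) : continuous (fun f : {ptws A -> R} => f x).
Proof. exact: (@proj_continuous A (fun _ => R) x). Qed.

Lemma gelfand_continuous x : continuous (gelfand x).
Proof.
move=> k; exact: (@continuous_comp K {ptws A -> R} R set_val (fun f => f x) k
  (@initial_continuous _ _ _ k) (@eval_continuous x (set_val k))).
Qed.

Lemma closed_eq_fun (T : topologicalType) (f g : T -> R) :
  continuous f -> continuous g -> closed [set x | f x = g x].
Proof.
move=> cf cg; have -> : [set x | f x = g x] = (f \- g) @^-1` [set x | x = 0].
  apply/seteqP; split=> x /= h; first by rewrite h subrr.
  by apply/eqP; rewrite -subr_eq0; apply/eqP.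
apply: preimage_closed; last exact: closed_eq.
by move=> x _; apply: continuousB; [exact: cf|exact: cg].
Qed.

Lemma characters_closed : closed characters.
Proof.
move=> phi clphi.
have inE (E : set {ptws A -> R}) : closed E -> characters `<=` E -> E phi.
  by move=> cE sE; apply: cE; apply: closureS clphi.
have cst (c : R) : continuous (fun _ : {ptws A -> R} => c) by exact: cst_continuous.
have cE (x : A) := @eval_continuous x.
split.
- move=> x nxA; apply: (inE [set f | f x = 0]); last by move=> f /char_out; apply.
  exact: (closed_eq_fun (cE x) (cst 0)).
- move=> x y xA yA; apply: (inE [set f | f (x + y) = f x + f y]).
    apply: (@closed_eq_fun {ptws A -> R} (fun f => f (x + y))
      (fun f => f x + f y) (cE _)) => f.
    by apply: continuousD; exact: cE.
  by move=> f /char_add; apply.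
- move=> a x xA; apply: (inE [set f | f (a *: x) = a * f x]).
    apply: (@closed_eq_fun {ptws A -> R} (fun f => f (a *: x))
      (fun f => a * f x) (cE _)) => f.
    by apply: continuousM; [exact: cst|exact: cE].
  by move=> f /char_scale; apply.
- move=> x y xA yA; apply: (inE [set f | f (mul x y) = f x * f y]).
    apply: (@closed_eq_fun {ptws A -> R} (fun f => f (mul x y))
      (fun f => f x * f y) (cE _)) => f.
    by apply: continuousM; exact: cE.
  by move=> f /char_mul; apply.
- move=> x xA; apply: (inE [set f | f (labs x) = `|f x|]).
    apply: (@closed_eq_fun {ptws A -> R} (fun f => f (labs x))
      (fun f => `|f x|) (cE _)) => f.
    apply: (@continuous_comp _ _ _ (fun f : {ptws A -> R} => f x)).
      exact: cE.
    exact: norm_continuous.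
  by move=> f /char_abs; apply.
- apply: (inE [set f | f e = 1]); last by move=> f /char_one.
  exact: (closed_eq_fun (cE e) (cst 1)).
Qed.

(** The bound |phi x| <= ||x|| places the characters in a product of segments, compact by
    Tychonoff. *)
Lemma characters_compact : compact characters.
Proof.
apply: (@subclosed_compact _ characters
  [set f | forall x, `[- `|x|, `|x|]%classic (f x)]).
- exact: characters_closed.
- exact: (@tychonoff A (fun _ => R) (fun x => `[- `|x|, `|x|]%classic)
    (fun x => @segment_compact _ _ _)).
- by move=> f chi x /=; rewrite in_itv /= -ler_norml; exact: char_norm.
Qed.

Lemma spectrum_compact : compact [set: K].
Proof.
move=> F FF _.
have FC : F (set_val @^-1` characters).
  by apply: filterS filterT => k _ /=; exact: set_valP.
have [phi [chi cl]] := @characters_compact (set_val @ F) _ FC.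
exists (exist _ phi (mem_set chi)); split=> // U V FU.
rewrite nbhsE => -[W [[B oB BW] Wk] WV].
have FS : F (set_val @^-1` (set_val @` U)).
  by apply: filterS FU => k Uk; exists k.
have nB : nbhs phi B by apply: open_nbhs_nbhs; split=> //; move: Wk; rewrite -BW.
have [_ [[k Uk <-] Bk]] := cl _ _ FS nB.
by exists k; split=> //; apply: WV; rewrite -BW.
Qed.

Lemma gelfand_ext (p q : K) : (forall x, gelfand x p = gelfand x q) -> p = q.
Proof. by move=> h; apply: val_inj; apply/funext => x; exact: h. Qed.

Lemma spectrum_hausdorff : hausdorff_space K.
Proof.
move=> p q cl; apply: gelfand_ext => x.
apply: (@norm_hausdorff _ R) => U V pU qV.
have [k [kU kV]] := cl _ _ (gelfand_continuous pU) (gelfand_continuous qV).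
by exists (gelfand x k).
Qed.

Lemma spectrum_inhabited : exists k : K, True.
Proof.
have [phi chi _] := character_norming one_ge0 Ae_one.
by have [k _] := char_gelfand chi; exists k.
Qed.

(** * Stone-Weierstrass and surjectivity *)

Lemma gelfand_interpolation (p q : K) (f : K -> R) :
  exists2 x, Ae x & gelfand x p = f p /\ gelfand x q = f q.
Proof.
have cp := gelfand_char p; have cq := gelfand_char q.
have [[x nx]|eqpq] := pselect (exists x, gelfand x p != gelfand x q); last first.
  have -> : p = q.
    apply: gelfand_ext => x; apply/eqP/negPn/negP => nx.
    by apply: eqpq; exists x.
  exists (f q *: e); first by apply: Ae_scale; exact: Ae_one.
  by rewrite /gelfand (char_scale_one cq).
(* Characters vanish off A_e, so an element that separates two of them lies in A_e. *)
have xA : Ae x.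
  apply: contrapT => nxA; move: nx.
  by rewrite /gelfand (char_out cp nxA) (char_out cq nxA) eqxx.
have d0 : gelfand x p - gelfand x q != 0 by rewrite subr_eq0.
pose a := (f p - f q) / (gelfand x p - gelfand x q).
have axA : Ae (a *: x) by exact: Ae_scale.
have beA : Ae ((f p - a * gelfand x p) *: e) by apply: Ae_scale; exact: Ae_one.
exists (a *: x + (f p - a * gelfand x p) *: e); first exact: Ae_add.
have ev (k : K) : gelfand (a *: x + (f p - a * gelfand x p) *: e) k
    = a * gelfand x k + (f p - a * gelfand x p).
  have ck := gelfand_char k.
  by rewrite /gelfand (char_add ck axA beA) (char_scale ck)// (char_scale_one ck).
rewrite !ev; split; first by ring.
by rewrite /a; field.
Qed.

(* Finite minima of interpolants bring the function below f + eps while keeping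
   its value at p; finite maxima over p then bring it above f - eps. *)
Lemma gelfand_dense (f : K -> R) : continuous f ->
  forall eps : R, 0 < eps ->
  exists2 x, Ae x & forall k, `|gelfand x k - f k| <= eps.
Proof.
move=> cf eps eps0.
have near_lt x (q : K) : gelfand x q = f q ->
    nbhs q [set k | `|gelfand x k - f k| < eps].
  move=> xq; have cg : {for q, continuous (gelfand x \- f)}.
    by apply: continuousB; [exact: gelfand_continuous|exact: cf].
  have /cvgrPdist_lt /(_ _ eps0) := cg; rewrite /= xq subrr.
  by apply: filterS => k /=; rewrite sub0r normrN.
have step1 (p : K) : exists2 x, Ae x & f p <= gelfand x p /\
    forall k, gelfand x k < f k + eps.
  pose P (U : set K) := exists2 x, Ae x & f p <= gelfand x p /\
    forall k, U k -> gelfand x k < f k + eps.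
  suff [x xA [h1 h2]] : P setT by exists x => //; split=> // k; exact: h2.
  apply: compact_induction; first exact: spectrum_compact.
  - by have [x xA [h _]] := gelfand_interpolation p p f; exists x; rewrite ?h.
  - by move=> U V UV [x xA [h1 h2]]; exists x => //; split=> // k /UV; exact: h2.
  - move=> U V [x xA [h1 h2]] [y yA [h1' h2']].
    exists (lattice_min x y); first exact: Ae_min.
    have ev k : gelfand (lattice_min x y) k = Num.min (gelfand x k) (gelfand y k).
      by rewrite /gelfand char_min//; exact: gelfand_char.
    split=> [|k]; first by rewrite ev le_min h1.
    by rewrite ev gt_min => -[/h2 ->//|/h2' ->]; rewrite orbT.
  - move=> q _; have [x xA [xp xq]] := gelfand_interpolation p q f.
    exists [set k | `|gelfand x k - f k| < eps]; first exact: near_lt.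
    exists x => //; rewrite xp; split=> // k /=; rewrite ltr_norml => /andP[_].
    by rewrite ltrBlDl.
pose P (U : set K) := exists2 x, Ae x & (forall k, gelfand x k < f k + eps) /\
    forall k, U k -> f k - eps < gelfand x k.
suff [x xA [h1 h2]] : P setT.
  exists x => // k; have := h2 k I; have := h1 k; rewrite ler_norml.
  by move=> ? ?; apply/andP; split; lra.
apply: compact_induction; first exact: spectrum_compact.
(* Even the empty set requires an element below f + eps, which [step1] supplies from any point of
   K. *)
- have [k _] := spectrum_inhabited; have [x xA [_ h]] := step1 k.
  by exists x.
- by move=> U V UV [x xA [h1 h2]]; exists x => //; split=> // k /UV; exact: h2.
- move=> U V [x xA [h1 h2]] [y yA [h1' h2']].
  exists (lattice_max x y); first exact: Ae_max.
  have ev k : gelfand (lattice_max x y) k = Num.max (gelfand x k) (gelfand y k).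
    by rewrite /gelfand char_max//; exact: gelfand_char.
  split=> k; first by rewrite ev gt_max h1 h1'.
  by rewrite ev lt_max => -[/h2 ->//|/h2' ->]; rewrite orbT.
- move=> p _; have [x xA [fx h]] := step1 p.
  exists [set k | f k - eps < gelfand x k]; last by exists x.
  have cg : {for p, continuous (gelfand x \- f)}.
    by apply: continuousB; [exact: gelfand_continuous|exact: cf].
  have /cvgrPdist_lt /(_ _ eps0) := cg.
  apply: filterS => k /=; rewrite ltr_norml => /andP[_] h'.
  by lra.
Qed.

(** Characters determine the order of A_e, so uniformly close transforms give |s n - s m| below a
    small multiple of e, hence norm closeness in A. *)
Lemma gelfand_surjective (f : K -> R) : continuous f ->
  exists2 x, Ae x & gelfand x = f.
Proof.
move=> cf; have inv0 n : (0 : R) < n.+1%:R^-1 by rewrite invr_gt0.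
have /choice [s hs] : forall n : nat, exists x, Ae x /\
    forall k, `|gelfand x k - f k| <= n.+1%:R^-1.
  by move=> n; have [x xA h] := gelfand_dense cf (inv0 n); exists x.
have sA n : Ae (s n) := (hs n).1.
have hc n m : `|s n - s m| <= 1 * (n.+1%:R^-1 + m.+1%:R^-1).
  have dA := Ae_sub (sA n) (sA m).
  rewrite mul1r; apply: norm_le_of_abs; first by rewrite addr_ge0// ltW.
  apply: character_le; [exact: Ae_abs|by apply: Ae_scale; exact: Ae_one|].
  move=> phi chi; have [k hk] := char_gelfand chi.
  rewrite (char_abs chi)// (char_scale_one chi) (char_sub chi)// !hk.
  have -> : gelfand (s n) k - gelfand (s m) k
          = (gelfand (s n) k - f k) - (gelfand (s m) k - f k) by ring.
  apply: le_trans (ler_normB _ _) _.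
  by apply: lerD; [exact: (hs n).2|exact: (hs m).2].
have [l hl] := cauchy_limit hc.
have lA : Ae l.
  apply: Ae_closed => eps eps0; have [N hN] := hl eps eps0.
  by exists (s N) => //; exact: hN.
exists l => //; apply/funext => k.
have ck := gelfand_char k.
apply/eqP; rewrite -subr_eq0 -normr_eq0 eq_le normr_ge0 andbT.
apply/ler_addgt0Pl => eps eps0; rewrite addr0.
have e2 : 0 < eps / 2 by exact: divr_gt0.
have [N hN] := hl _ e2.
pose n := maxn N (Num.bound (eps / 2)^-1).
have -> : gelfand l k - f k
        = (gelfand (s n) k - f k) - (gelfand (s n) k - gelfand l k) by ring.
apply: le_trans (ler_normB _ _) _; rewrite [leRHS]splitr; apply: lerD.
  apply: le_trans ((hs n).2 k) _.
  rewrite -[leRHS]invrK lef_pV2 ?posrE ?invr_gt0//.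
  apply: ltW; apply: (@lt_le_trans _ _ (Num.bound (eps / 2)^-1)%:R).
    by apply: archi_boundP; rewrite invr_ge0 ltW.
  by rewrite ler_nat; apply: leq_trans (leq_maxr N _) (leqnSn _).
rewrite /gelfand -(char_sub ck)//.
apply: le_trans (char_norm ck _) _; apply: hN; exact: leq_maxl.
Qed.

(** The supremum over the circle is attained at the argument of (a, b): acos (a / r) when b >= 0,
    and its reflection 2 pi - acos (a / r) when b < 0. *)
Lemma polar_angle (a b : R) : exists2 t : R, 0 <= t <= 2 * pi &
  cos t * a + sin t * b = Num.sqrt (a ^+ 2 + b ^+ 2).
Proof.
have pi0 := pi_ge0 R.
set r := Num.sqrt _.
have s0 : 0 <= a ^+ 2 + b ^+ 2 by rewrite addr_ge0// sqr_ge0.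
have rr : r ^+ 2 = a ^+ 2 + b ^+ 2 by rewrite sqr_sqrtr.
have [r0|rn0] := eqVneq r 0.
  move: rr; rewrite r0 expr0n /= => /esym/eqP.
  rewrite paddr_eq0 ?sqr_ge0// !sqrf_eq0 => /andP[/eqP-> /eqP->].
  by exists 0; rewrite ?mulr0 ?addr0//; apply/andP; split; lra.
have rgt0 : 0 < r by rewrite lt_def rn0 sqrtr_ge0.
have cI : -1 <= a / r <= 1.
  rewrite -ler_norml normf_div (gtr0_norm rgt0) ler_pdivrMr// mul1r.
  by rewrite -sqrtr_sqr; apply: ler_wsqrtr; rewrite lerDl sqr_ge0.
have hsin : sin (acos (a / r)) = `|b| / r.
  rewrite sin_acos//; have -> : 1 - (a / r) ^+ 2 = (b / r) ^+ 2.
    by rewrite !expr_div_n rr; field; rewrite -rr expf_neq0.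
  by rewrite sqrtr_sqr normf_div (gtr0_norm rgt0).
have hcos : cos (acos (a / r)) = a / r by apply: acosK; rewrite in_itv.
have tI : 0 <= acos (a / r) <= pi by rewrite acos_ge0// acos_lepi.
have [b0|b0] := leP 0 b.
  exists (acos (a / r)); first by move: tI => /andP[? ?]; apply/andP; split; lra.
  rewrite hcos hsin ger0_norm//.
  have -> : a / r * a + b / r * b = (a ^+ 2 + b ^+ 2) / r by ring.
  by rewrite -rr; field.
exists (2 * pi - acos (a / r)).
  by move: tI => /andP[? ?]; apply/andP; split; lra.
have -> : 2 * pi - acos (a / r) = - acos (a / r) + pi *+ 2 by rewrite mulr2n; ring.
rewrite cosD2pi sinD2pi cosN sinN hcos hsin ltr0_norm//.
have -> : a / r * a + - (- b / r) * b = (a ^+ 2 + b ^+ 2) / r by ring.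
by rewrite -rr; field.
Qed.

(* By surjectivity sqrt (x^2 + y^2) is the transform of some m in A_e, and m
   bounds all cos t x + sin t y, hence |z| <= m. *)
Lemma char_cxmod phi z : character phi -> ACe z ->
  phi (modc z) = Num.sqrt (phi z.1 ^+ 2 + phi z.2 ^+ 2).
Proof.
move=> chi zA; have mA := ACe_cxmod zA.
have [z1 z2] : Ae z.1 /\ Ae z.2 by move: zA; rewrite ACeE.
have combA t : Ae (cos t *: z.1 + sin t *: z.2).
  by apply: Ae_add; exact: Ae_scale.
have evc psi t : character psi ->
    psi (cos t *: z.1 + sin t *: z.2) = cos t * psi z.1 + sin t * psi z.2.
  by move=> ch; rewrite (char_add ch) ?(char_scale ch)//; exact: Ae_scale.
apply/eqP; rewrite eq_le; apply/andP; split; last first.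
  have [t tI <-] := polar_angle (phi z.1) (phi z.2).
  by rewrite -evc//; apply: (char_mono chi) => //; exact: cxmod_ge.
pose f (k : K) := Num.sqrt (gelfand z.1 k ^+ 2 + gelfand z.2 k ^+ 2).
have [|m mAe mf] := @gelfand_surjective f.
  move=> k; apply: (@continuous_comp _ _ _
    (fun k => gelfand z.1 k ^+ 2 + gelfand z.2 k ^+ 2)).
    by apply: continuousD; apply: continuousM; exact: gelfand_continuous.
  exact: sqrt_continuous.
have [k hk] := char_gelfand chi.
rewrite !hk -/(f k) -mf -!hk; apply: (char_mono chi) => //.
apply: cxmod_le => t _; apply: character_le => // psi ch; rewrite evc//.
have [j hj] := char_gelfand ch; rewrite !hj mf /f.
apply: le_trans (ler_norm _) _; rewrite -sqrtr_sqr; apply: ler_wsqrtr.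
set a := gelfand _ _; set b := gelfand _ _.
rewrite -subr_ge0.
(* Cauchy-Schwarz through Lagrange's identity; the last summand vanishes because cos^2 + sin^2 =
   1. *)
have -> : a ^+ 2 + b ^+ 2 - (cos t * a + sin t * b) ^+ 2
        = (sin t * a - cos t * b) ^+ 2
          + (1 - (cos t ^+ 2 + sin t ^+ 2)) * (a ^+ 2 + b ^+ 2) by ring.
by rewrite cos2Dsin2 subrr mul0r addr0 sqr_ge0.
Qed.

(** * Complexification and spectrum *)

Definition gelfandC (z : cplx A) (k : K) : R[i] :=
  Complex (gelfand z.1 k) (gelfand z.2 k).

Lemma cxabs_gelfandC z k : ACe z -> cxabs (gelfandC z k) = gelfand (modc z) k.
Proof. by move=> zA; rewrite /gelfand (char_cxmod (gelfand_char k) zA). Qed.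

Lemma ACe_fst z : ACe z -> Ae z.1. Proof. by rewrite ACeE => -[]. Qed.
Lemma ACe_snd z : ACe z -> Ae z.2. Proof. by rewrite ACeE => -[]. Qed.

Lemma ACe_pair x y : Ae x -> Ae y -> ACe (x, y).
Proof. by move=> xA yA; rewrite ACeE. Qed.

Lemma ACe_one : ACe (cxone e).
Proof. by apply: ACe_pair; [exact: Ae_one|exact: Ae0]. Qed.

Lemma ACe_add z w : ACe z -> ACe w -> ACe (cxadd z w).
Proof.
by move=> zA wA; apply: ACe_pair; apply: Ae_add; (exact: ACe_fst || exact: ACe_snd).
Qed.

Lemma ACe_opp z : ACe z -> ACe (cxopp z).
Proof.
by move=> zA; apply: ACe_pair; apply: Ae_opp; (exact: ACe_fst || exact: ACe_snd).
Qed.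

Lemma ACe_scale (c : R[i]) z : ACe z -> ACe (cxscale c z).
Proof.
move=> zA; have z1 := ACe_fst zA; have z2 := ACe_snd zA.
by apply: ACe_pair; [apply: Ae_sub|apply: Ae_add]; exact: Ae_scale.
Qed.

Lemma ACe_mul z w : ACe z -> ACe w -> ACe (cxmul mul z w).
Proof.
move=> zA wA; have z1 := ACe_fst zA; have z2 := ACe_snd zA.
have w1 := ACe_fst wA; have w2 := ACe_snd wA.
by apply: ACe_pair; [apply: Ae_sub|apply: Ae_add]; exact: Ae_mul.
Qed.

Lemma gelfandC_add z w k : ACe z -> ACe w ->
  gelfandC (cxadd z w) k = gelfandC z k + gelfandC w k.
Proof.
move=> zA wA; have ck := gelfand_char k.
by rewrite /gelfandC /gelfand /= !(char_add ck) //;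
  (exact: ACe_fst || exact: ACe_snd).
Qed.

Lemma gelfandC_scale (c : R[i]) z k : ACe z ->
  gelfandC (cxscale c z) k = c * gelfandC z k.
Proof.
case: c => a b zA; have ck := gelfand_char k.
have z1 := ACe_fst zA; have z2 := ACe_snd zA.
rewrite /gelfandC /gelfand /= (char_sub ck) ?(char_add ck) ?(char_scale ck)//;
  by exact: Ae_scale.
Qed.

Lemma gelfandC_mul z w k : ACe z -> ACe w ->
  gelfandC (cxmul mul z w) k = gelfandC z k * gelfandC w k.
Proof.
move=> zA wA; have ck := gelfand_char k.
have z1 := ACe_fst zA; have z2 := ACe_snd zA.
have w1 := ACe_fst wA; have w2 := ACe_snd wA.
rewrite /gelfandC /gelfand /= (char_sub ck) ?(char_add ck) ?(char_mul ck)//;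
  by exact: Ae_mul.
Qed.

Lemma gelfandC_one k : gelfandC (cxone e) k = 1.
Proof.
have ck := gelfand_char k.
by rewrite /gelfandC /gelfand /= (char_one ck) (char0 ck).
Qed.

Lemma gelfandC_inj z w : ACe z -> ACe w -> gelfandC z = gelfandC w -> z = w.
Proof.
case: z w => [x y] [x' y'] zA wA h.
have hk k : gelfand x k = gelfand x' k /\ gelfand y k = gelfand y' k.
  by have := congr1 (fun f => f k) h => -[].
congr pair; apply: character_eq.
- exact: (ACe_fst zA).
- exact: (ACe_fst wA).
- by move=> phi /char_gelfand[k hk']; rewrite !hk'; exact: (hk k).1.
- exact: (ACe_snd zA).
- exact: (ACe_snd wA).
- by move=> phi /char_gelfand[k hk']; rewrite !hk'; exact: (hk k).2.
Qed.

Lemma gelfandC_surjective (f : K -> R[i]) : continuousC f ->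
  exists2 z, ACe z & gelfandC z = f.
Proof.
move=> [/gelfand_surjective[x xA xf] /gelfand_surjective[y yA yf]].
exists (x, y); first exact: ACe_pair.
by apply/funext => k; rewrite /gelfandC /= xf yf; case: (f k).
Qed.

(** The supremum is attained at a character norming |z|. *)
Lemma cxnorm_supnormC z : ACe z -> cxnorm le z = supnormC (gelfandC z).
Proof.
move=> zA; have mA := ACe_cxmod zA; have m0 := cxmod_ge0 z.
have [phi chi hphi] := character_norming m0 mA.
have [k0 hk0] := char_gelfand chi.
have ub : ubound [set cxabs (gelfandC z k) | k in [set: K]] (cxnorm le z).
  move=> _ [k _ <-]; rewrite cxabs_gelfandC//.
  exact: le_trans (ler_norm _) (char_norm (gelfand_char k) _).
have inS : [set cxabs (gelfandC z k) | k in [set: K]] (cxnorm le z).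
  by exists k0 => //; rewrite cxabs_gelfandC// -hk0.
apply/eqP; rewrite eq_le; apply/andP; split.
  by apply: ub_le_sup => //; exists (cxnorm le z).
by apply: ge_sup => //; exists (cxnorm le z).
Qed.

Lemma gelfandC_iso : iso_CK le mul ACe gelfandC.
Proof.
repeat split.
- exact: gelfand_continuous.
- exact: gelfand_continuous.
- exact: gelfandC_surjective.
- exact: gelfandC_inj.
- by move=> z w zA wA; apply/funext => k; exact: gelfandC_add.
- by move=> c z zA; apply/funext => k; exact: gelfandC_scale.
- by move=> z w zA wA; apply/funext => k; exact: gelfandC_mul.
- move=> z zA; apply/funext => k; rewrite cxabs_gelfandC//.
  by rewrite /gelfandC /gelfand /= (char0 (gelfand_char k)).
- exact: cxnorm_supnormC.
Qed.

(** An inverse in A_C lies in (A_C)_e by inverse closedness, so the transform applies to it.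
    Conversely, the conjugate over the squared modulus is continuous and lifts by surjectivity. *)
Lemma cinvertible_gelfandC z : ACe z ->
  cinvertible mul e z <-> forall k, gelfandC z k != 0.
Proof.
move=> zA; split=> [[w [zw wz]] k|nz].
  have wA := ACe_inverse_closed zA zw wz.
  have := gelfandC_mul k zA wA; rewrite zw gelfandC_one => h.
  by apply/eqP => z0; move: h; rewrite z0 mul0r => /eqP; rewrite oner_eq0.
pose n (k : K) := gelfand z.1 k ^+ 2 + gelfand z.2 k ^+ 2.
have n0 k : n k != 0.
  apply/negP; rewrite /n paddr_eq0 ?sqr_ge0// !sqrf_eq0 => /andP[/eqP h1 /eqP h2].
  by have := nz k; rewrite /gelfandC h1 h2 eqxx.
have cn k : {for k, continuous (fun k => gelfand z.1 k ^+ 2 + gelfand z.2 k ^+ 2)}.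
  by apply: continuousD; apply: continuousM; exact: gelfand_continuous.
have cni k : {for k, continuous (fun k => (n k)^-1)}.
  by apply: continuousV; [exact: n0|exact: cn].
have [|w wA wf] := @gelfandC_surjective
    (fun k => Complex (gelfand z.1 k * (n k)^-1) (- gelfand z.2 k * (n k)^-1)).
  have cM (g : K -> R) : continuous g -> continuous (fun k => g k * (n k)^-1).
    move=> cg k; apply: (@continuousM _ _ g (fun k => (n k)^-1)); last exact: cni.
    exact: cg.
  split; first exact: (cM _ (@gelfand_continuous z.1)).
  apply: (cM (fun k => - gelfand z.2 k)) => k.
  exact: (continuousN (@gelfand_continuous z.2 k)).
have wz k : gelfandC z k * gelfandC w k = 1.
  rewrite wf /gelfandC; apply/eqP; rewrite eq_complex /=; apply/andP; split; apply/eqP.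
    by rewrite /n; have := n0 k; rewrite /n => nk; field.
  by ring.
exists w; split; apply: gelfandC_inj; rewrite ?ACe_one//.
- exact: ACe_mul.
- exact: ACe_one.
- by apply/funext => k; rewrite gelfandC_mul// wz gelfandC_one.
- exact: ACe_mul.
- exact: ACe_one.
(* The other-sided identity comes from commutativity of [R[i]], through injectivity of the
   transform. *)
- by apply/funext => k; rewrite gelfandC_mul// mulrC wz gelfandC_one.
Qed.

Lemma gelfandC_opp z k : ACe z -> gelfandC (cxopp z) k = - gelfandC z k.
Proof.
move=> zA; have ck := gelfand_char k.
by rewrite /gelfandC /gelfand /= !(char_opp ck) //;
  (exact: ACe_fst || exact: ACe_snd).
Qed.

Lemma spectrum_range z : ACe z -> spectrum mul e z = range (gelfandC z).
Proof.
move=> zA; pose zc (c : R[i]) := cxadd z (cxopp (cxscale c (cxone e))).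
have cA c : ACe (cxscale c (cxone e)) := ACe_scale c ACe_one.
have zcA c : ACe (zc c) := ACe_add zA (ACe_opp (cA c)).
have zcE c k : gelfandC (zc c) k = gelfandC z k - c.
  rewrite gelfandC_add ?gelfandC_opp ?gelfandC_scale ?gelfandC_one ?mulr1//.
  - exact: ACe_one.
  - exact: ACe_opp.
apply/seteqP; split=> [c nI|_ [k _ <-]].
  apply: contrapT => nr; apply: nI; apply/(cinvertible_gelfandC (zcA c)) => k.
  by rewrite zcE subr_eq0; apply/eqP => zk; apply: nr; exists k.
move/(cinvertible_gelfandC (zcA _)) => /(_ k).
by rewrite zcE subrr eqxx.
Qed.

Lemma spectral_radius_cxnorm z : ACe z -> spectral_radius mul e z = cxnorm le z.
Proof.
move=> zA; rewrite cxnorm_supnormC// /spectral_radius /supnormC; congr sup.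
rewrite spectrum_range//; apply/seteqP; split=> [_ [_ [k _ <-] <-]|_ [k _ <-]].
  by exists k.
by exists (gelfandC z k) => //; exists k.
Qed.

Lemma norm_e_cxnorm z : ACe z -> norm_e le e z = cxnorm le z.
Proof.
move=> zA; rewrite /norm_e inf_order_unit//; first exact: cxmod_ge0.
exact: ACe_cxmod.
Qed.

Lemma complex_band_decomposition z : exists w v,
  [/\ ACe w, disjoint_compl le join ACe v & z = cxadd w v].
Proof.
have [p1 [q1 [p1A q1d z1E]]] := band_decomposition z.1.
have [p2 [q2 [p2A q2d z2E]]] := band_decomposition z.2.
exists (p1, p2), (q1, q2); split; first exact: ACe_pair.
  exact/disjoint_complP.
by rewrite /cxadd /= -z1E -z2E; case: (z).
Qed.

(** x - x' = y' - y lies in A_e and is disjoint from e. *)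
Lemma band_decomposition_unique x y x' y' : Ae x -> Ae x' ->
  disjoint_elt e (labs y) -> disjoint_elt e (labs y') ->
  x + y = x' + y' -> x = x' /\ y = y'.
Proof.
move=> xA xA' yd yd' h.
have xy : x - x' = y' - y.
  have -> : x = (x + y) - y by lin.
  by rewrite h; lin.
have /eqP : x - x' = 0.
  apply: disjoint_one_eq0; first exact: Ae_sub.
  rewrite xy; apply: disjoint_abs_add => //; first exact: one_ge0.
  by rewrite absN.
rewrite subr_eq0 => /eqP xx; split=> //.
by move: h; rewrite xx => /addrI.
Qed.

Lemma complex_band_decomposition_unique w v w' v' : ACe w ->
  disjoint_compl le join ACe v -> ACe w' -> disjoint_compl le join ACe v' ->
  cxadd w v = cxadd w' v' -> w = w' /\ v = v'.
Proof.
move=> wA /disjoint_complP[d1 d2] wA' /disjoint_complP[d1' d2'] [h1 h2].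
have [e1 f1] := band_decomposition_unique (ACe_fst wA) (ACe_fst wA') d1 d1' h1.
have [e2 f2] := band_decomposition_unique (ACe_snd wA) (ACe_snd wA') d2 d2' h2.
by split; apply/eqP; rewrite -pair_eqE /pair_eq /= ?e1 ?f1 ?e2 ?f2 !eqxx.
Qed.

Lemma norm_order_unit x : Ae x ->
  `|x| = inf [set l : R | 0 < l /\ le (labs x) (l *: e)].
Proof.
move=> xA; rewrite inf_order_unit ?norm_abs//; first exact: abs_ge0.
exact: Ae_abs.
Qed.

End BanachLatticeAlgebra_unit.

Theorem mainTheorem13 (R : realType) (A : completeNormedModType R)
  (le : A -> A -> Prop) (join mul : A -> A -> A) (e : A) :
  BanachLatticeAlgebra le join mul e ->
  (* (A_C)_e = (A_e)_C = A_e + i A_e *)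
  ACe le e = [set z | Ae le join e z.1 /\ Ae le join e z.2] /\
  (* (i) ||z||_C = ||z||_e = r(z) on (A_C)_e *)
  (forall z, ACe le e z ->
     cxnorm le z = norm_e le e z /\ norm_e le e z = spectral_radius mul e z) /\
  (* (i) ((A_C)_e, ||.||_C) is isometrically lattice and algebra isomorphic to C(K, C) *)
  (exists (K : topologicalType) (Phi : cplx A -> K -> R[i]),
     hausdorff_space K /\ compact [set: K] /\ iso_CK le mul (ACe le e) Phi) /\
  (* (i) on A_e, ||.|| and ||.||_e coincide *)
  (forall x, Ae le join e x ->
     `|x| = inf [set l : R | 0 < l /\ le (labs join x) (l *: e)]) /\
  (* (ii) (A_C)_e is a projection band: A_C = (A_C)_e (+) (A_C)_e^d *)
  (forall z, exists w v, ACe le e w /\ disjoint_compl le join (ACe le e) v /\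
                         z = cxadd w v) /\
  (forall w v w' v', ACe le e w -> disjoint_compl le join (ACe le e) v ->
     ACe le e w' -> disjoint_compl le join (ACe le e) v' ->
     cxadd w v = cxadd w' v' -> w = w' /\ v = v') /\
  (* (iii) (A_C)_e is an inverse closed subalgebra of A_C *)
  (ACe le e (cxone e) /\
   (forall z w, ACe le e z -> ACe le e w -> ACe le e (cxadd z w)) /\
   (forall (c : R[i]) z, ACe le e z -> ACe le e (cxscale c z)) /\
   (forall z w, ACe le e z -> ACe le e w -> ACe le e (cxmul mul z w)) /\
   (forall b w, ACe le e b -> cxmul mul b w = cxone e -> cxmul mul w b = cxone e ->
      ACe le e w)).
Proof.
move=> bla; split; first exact: (ACeE bla).
split.
  move=> z zA; rewrite (spectral_radius_cxnorm bla)//.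
  by rewrite (norm_e_cxnorm bla).
split.
  exists (set_type (characters le join mul e)), (@gelfandC R A le join mul e).
  split; first exact: spectrum_hausdorff.
  split; first exact: (spectrum_compact bla).
  exact: (gelfandC_iso bla).
split; first exact: (norm_order_unit bla).
split.
  move=> z; have [w [v [wA vd zE]]] := complex_band_decomposition bla z.
  by exists w, v.
split; first exact: (complex_band_decomposition_unique bla).
split; first exact: (ACe_one bla).
split; first exact: (ACe_add bla).
split; first exact: (ACe_scale bla).
split; first exact: (ACe_mul bla).
exact: (ACe_inverse_closed bla).
Qed.
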